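(* Strong Outlier Recognition for NU quasi-acyclic default theories is in P. That is, for a fixed positive integer $c$, the following problem is decidable in deterministic polynomial time: given an NU default theory $\Delta=(D,W)$ of tightness at most $c$ and a set of literals $L\subseteq W$, is $L$ a strong outlier set in $\Delta$ (for some strong outlier witness set $S$)?
   Context: For a set of formulas $T$, $T^*$ is its logical closure; $\neg\neg a=a$ for a letter $a$. A normal unary (NU) default theory is a pair $(D,W)$ with $W$ a finite consistent set of propositional literals and $D$ a finite set of defaults $\frac{\alpha:\beta}{\beta}$, where $\beta$ is a single literal and the prerequisite $\alpha$ is empty or a single positive literal. A set $\mathcal E$ is an extension of $(D,W)$ if $\mathcal E=\bigcup_{i\ge0}E_i$, where $E_0=W$ and $E_{i+1}=E_i^*\cup\{\beta \mid \frac{\alpha:\beta}{\beta}\in D,\ \alpha\in E_i \text{ (or } \alpha \text{ empty)},\ \neg\beta\notin\mathcal E\}$. $(D,W)\models\phi$ means $\phi$ belongs to every extension of $(D,W)$. The atomic dependency graph of the theory is the directed graph whose vertices are the letters occurring in it, with an edge $(x,y)$ whenever letters $x$ and $y$ occur respectively in the prerequisite and the consequent of some default in $D$. The tightness is the number of letters in the largest strongly connected component of this graph. For a fixed positive integer $c$, the theory is ($c$-)quasi-acyclic if its tightness is at most $c$. Strong outliers: a set of literals $L\subset W$ is a strong outlier set in $\Delta=(D,W)$, with strong outlier witness set $S$, if $S$ is a non-empty subset of $W\setminus L$ such that (1) for all $\ell\in S$, $(D,W\setminus S)\models\neg\ell$, and (2) for all $\ell\in S$, $(D,W\setminus(S\cup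 L))\not\models\neg\ell$. *)

(* Defs.v *)
From HB Require Import structures.
From mathcomp Require Import all_boot.
From mathcomp Require Import classical_sets.

Set Implicit Arguments.
Unset Strict Implicit.
Unset Printing Implicit Defensive.

Local Open Scope classical_set_scope.

(** * Propositional logic *)

(* Letters are named by arbitrary binary words, so that the space taken by the
   name of a letter is accounted for in the size of an instance. *)
Definition letter := seq bool.

Inductive formula :=
  | FVar of letter
  | FBot
  | FNot of formula
  | FAnd of formula & formula
  | FOr of formula & formula
  | FImp of formula & formula.

Fixpoint holds (v : letter -> bool) (f : formula) : bool :=
  match f with
  | FVar a => v a
  | FBot => false
  | FNot g => ~~ holds v g
  | FAnd g h => holds v g && holds v h
  | FOr g h => holds v g || holds v h
  | FImp g h => holds v g ==> holds v h
  end.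

Definition logical_closure (T : set formula) : set formula :=
  [set f | forall v, (forall g, T g -> holds v g) -> holds v f].

Definition consistent (T : set formula) : Prop := ~ logical_closure T FBot.

(* [(true, a)] is the literal a, and [(false, a)] is the literal ~a. *)
Definition literal := (bool * letter)%type.

Definition lit_neg (l : literal) : literal := (~~ l.1, l.2).

Definition lit_formula (l : literal) : formula :=
  if l.1 then FVar l.2 else FNot (FVar l.2).

(* Finite sets are presented by sequences; everything below depends only on
   their elements. *)
Definition lit_set (W : seq literal) : set formula :=
  [set f | exists2 l, l \in W & f = lit_formula l].

(** * Normal unary default theories *)

(* [(p, b)] is the default p : b / b, where p is [None] if the prerequisite is
   empty, and [Some a] if it is the positive literal a. *)
Definition default := (option letter * literal)%type.

Definition prerequisite (d : default) : option letter := d.1.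
Definition consequent (d : default) : literal := d.2.

Definition is_nu_theory (D : seq default) (W : seq literal) : Prop :=
  consistent (lit_set W).

Definition prerequisite_in (d : default) (T : set formula) : Prop :=
  if prerequisite d is Some a then T (FVar a) else True.

Fixpoint stage (D : seq default) (W : seq literal) (E : set formula) (i : nat)
    : set formula :=
  if i is j.+1 then
    logical_closure (stage D W E j) `|`
    [set f | exists2 d, d \in D &
       [/\ prerequisite_in d (stage D W E j),
           ~ E (lit_formula (lit_neg (consequent d)))
         & f = lit_formula (consequent d)]]
  else lit_set W.

Definition is_extension (D : seq default) (W : seq literal) (E : set formula)
    : Prop :=
  E = [set f | exists i, stage D W E i f].

Definition entails (D : seq default) (W : seq literal) (f : formula) : Prop :=
  forall E, is_extension D W E -> E f.

(** * Atomic dependency graph and tightness *)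

Definition default_letters (d : default) : seq letter :=
  rcons (seq_of_opt (prerequisite d)) (consequent d).2.

Definition theory_letters (D : seq default) (W : seq literal) : seq letter :=
  flatten (map default_letters D) ++ map snd W.

Definition dep_vertex (D : seq default) (W : seq literal) : finType :=
  seq_sub (theory_letters D W).

Definition dep_edge (D : seq default) (W : seq literal)
    : rel (dep_vertex D W) :=
  fun x y => has (fun d => (prerequisite d == Some (val x)) &&
                           ((consequent d).2 == val y)) D.

Definition scc (V : finType) (e : rel V) (x : V) : {set V} :=
  [set y | connect e x y && connect e y x]%SET.

Definition tightness (D : seq default) (W : seq literal) : nat :=
  \max_(x : dep_vertex D W) #|scc (@dep_edge D W) x|.

Definition quasi_acyclic (c : nat) (D : seq default) (W : seq literal) : Prop :=
  tightness D W <= c.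

(** * Strong outliers *)

Definition lits_minus (A B : seq literal) : seq literal :=
  [seq l <- A | l \notin B].

Definition strong_outlier_witness (D : seq default) (W L S : seq literal)
    : Prop :=
  [/\ S != [::],
      {subset S <= lits_minus W L},
      forall l, l \in S ->
        entails D (lits_minus W S) (lit_formula (lit_neg l))
    & forall l, l \in S ->
        ~ entails D (lits_minus W (S ++ L)) (lit_formula (lit_neg l))].

Definition strong_outlier_set (D : seq default) (W L : seq literal) : Prop :=
  {subset L <= W} /\ exists S, strong_outlier_witness D W L S.

(** * Deterministic polynomial time *)

(* A tape is infinite in both directions. [lhs] lists the cells to the left of
   the scanned one, nearest first, and [rhs] those to its right, nearest first;
   the cells beyond them are blank, and a blank cell holds [None]. *)
Record tape (G : Type) := Tape {
  lhs : seq (option G);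
  scanned : option G;
  rhs : seq (option G) }.

Inductive move := MoveLeft | Stay | MoveRight.

Definition write_tape (G : Type) (a : option G) (t : tape G) : tape G :=
  Tape (lhs t) a (rhs t).

Definition move_tape (G : Type) (m : move) (t : tape G) : tape G :=
  match m with
  | MoveLeft =>
      Tape (behead (lhs t)) (head None (lhs t)) (scanned t :: rhs t)
  | Stay => t
  | MoveRight =>
      Tape (scanned t :: lhs t) (head None (rhs t)) (behead (rhs t))
  end.

(* A deterministic Turing machine over the input alphabet A with tm_work.+1
   tapes. The non-blank tape symbols are the input symbols [inl a] and the
   auxiliary symbols [inr x]. A state q is halting if [tm_verdict q] is
   [Some true] (accept) or [Some false] (reject). *)
Record turing_machine (A : finType) := TuringMachine {
  tm_work : nat;
  tm_aux : finType;
  tm_state : finType;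
  tm_start : tm_state;
  tm_verdict : tm_state -> option bool;
  tm_trans :
    tm_state -> {ffun 'I_tm_work.+1 -> option (A + tm_aux)} ->
    tm_state * {ffun 'I_tm_work.+1 -> option (A + tm_aux) * move} }.

Section Run.
Variables (A : finType) (M : turing_machine A).

Definition tm_tape := tape (A + tm_aux M)%type.

Record config := Config {
  cf_state : tm_state M;
  cf_tapes : {ffun 'I_(tm_work M).+1 -> tm_tape} }.

(* The head of the input tape initially scans the first input symbol. *)
Definition input_tape (w : seq A) : tm_tape :=
  let s := [seq Some (inl a) | a <- w] in Tape [::] (head None s) (behead s).

Definition init_config (w : seq A) : config :=
  Config (tm_start M)
    [ffun i => if i == ord0 then input_tape w else Tape [::] None [::]].

Definition step (cf : config) : config :=
  if tm_verdict (cf_state cf) is Some _ then cf else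
  let r := tm_trans (cf_state cf) [ffun i => scanned (cf_tapes cf i)] in
  Config r.1
    [ffun i => move_tape (r.2 i).2 (write_tape (r.2 i).1 (cf_tapes cf i))].

Definition halts_within (w : seq A) (n : nat) (b : bool) : Prop :=
  tm_verdict (cf_state (iter n step (init_config w))) = Some b.

Definition decides_in_time (X : set (seq A)) (T : nat -> nat) : Prop :=
  forall w, exists2 b, halts_within w (T (size w)) b & (b <-> X w).

End Run.

Definition in_P (A : finType) (X : set (seq A)) : Prop :=
  exists (M : turing_machine A) (a k : nat),
    decides_in_time M X (fun n => a * n ^ k + a).

(** * Instances as words over a finite alphabet *)

Inductive symbol := Bit of bool | Sign of bool | Colon | Semicolon | Bar.

Definition symbol_code (s : symbol) : bool + bool + option (option unit) :=
  match s with
  | Bit b => inl (inl b)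
  | Sign b => inl (inr b)
  | Colon => inr None
  | Semicolon => inr (Some None)
  | Bar => inr (Some (Some tt))
  end.

Definition symbol_decode (s : bool + bool + option (option unit)) : symbol :=
  match s with
  | inl (inl b) => Bit b
  | inl (inr b) => Sign b
  | inr None => Colon
  | inr (Some None) => Semicolon
  | inr (Some (Some _)) => Bar
  end.

Lemma symbol_codeK : cancel symbol_code symbol_decode.
Proof. by case. Qed.

HB.instance Definition _ := Countable.copy symbol (can_type symbol_codeK).
HB.instance Definition _ : isFinite symbol := CanIsFinite symbol_codeK.

Definition encode_literal (l : literal) : seq symbol :=
  Sign l.1 :: map Bit l.2.

Definition encode_default (d : default) : seq symbol :=
  (if prerequisite d is Some a then encode_literal (true, a) else [::]) ++
  Colon :: encode_literal (consequent d) ++ [:: Semicolon].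

Definition encode_instance (D : seq default) (W L : seq literal)
    : seq symbol :=
  flatten (map encode_default D) ++
  Bar :: flatten (map encode_literal W) ++
  Bar :: flatten (map encode_literal L).

Definition is_bit (s : symbol) : bool := if s is Bit _ then true else false.

Lemma bits_inj (x y : seq bool) (s t : seq symbol) :
  ~~ is_bit (head Bar s) -> ~~ is_bit (head Bar t) ->
  map Bit x ++ s = map Bit y ++ t -> x = y /\ s = t.
Proof.
move=> hs ht; elim: x y => [|b x IH] [|b' y] //=.
- by move=> E; move: hs; rewrite E.
- by move=> E; move: ht; rewrite -E.
- by case=> -> /IH [-> ->].
Qed.

Definition is_sign (s : symbol) : bool := if s is Sign _ then true else false.

Lemma literals_inj (W W' : seq literal) (s t : seq symbol) :
  let stops u := ~~ is_bit (head Bar u) && ~~ is_sign (head Bar u) in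
  stops s -> stops t ->
  flatten (map encode_literal W) ++ s = flatten (map encode_literal W') ++ t ->
  W = W' /\ s = t.
Proof.
move=> /= /andP[bs ss] /andP[bt st].
have nb (V : seq literal) u : ~~ is_bit (head Bar u) ->
    ~~ is_bit (head Bar (flatten (map encode_literal V) ++ u)) by case: V.
elim: W W' => [|[b x] W IH] [|[b' y] W'] //=.
- by move=> E; move: ss; rewrite E.
- by move=> E; move: st; rewrite -E.
- by case=> ->; rewrite -!catA => /bits_inj[]; rewrite ?nb // => -> /IH [-> ->].
Qed.

Lemma default_inj (d d' : default) (s t : seq symbol) :
  encode_default d ++ s = encode_default d' ++ t -> d = d' /\ s = t.
Proof.
rewrite /encode_default -!catA /=.
case: d d' => [[a|] [b x]] [[a'|] [b' x']] //=; rewrite -?catA /=.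
- case=> /bits_inj[] // -> [->].
  by move=> /bits_inj[] // -> [->].
- by case=> -> /bits_inj[] // -> [->].
Qed.

Lemma encode_instance_inj (D D' : seq default) (W W' L L' : seq literal) :
  encode_instance D W L = encode_instance D' W' L' ->
  [/\ D = D', W = W' & L = L'].
Proof.
rewrite /encode_instance.
elim: D D' => [|d D IH] [|d' D'] /=.
- case=> /literals_inj[] // -> [] E.
  have := @literals_inj L L' [::] [::]; rewrite !cats0.
  by case=> // ->.
- by case: d' => [[a|] [b x]].
- by case: d => [[a|] [b x]].
- by rewrite -2!(catA (encode_default _)) => /default_inj[-> /IH[-> -> ->]].
Qed.

(* The words over [symbol] that are not encodings of an instance satisfying the
   input conditions have to be rejected. *)
Definition strong_outlier_recognition (c : nat) : set (seq symbol) :=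
  [set w | exists D W L,
     [/\ w = encode_instance D W L, is_nu_theory D W, quasi_acyclic c D W
       & strong_outlier_set D W L]].

(* Main.v *)
Require Import Defs.
From HB Require Import structures.
From mathcomp Require Import all_boot zify.
From mathcomp Require Import classical_sets.
From mathcomp Require boolp.

(** An extension of an NU theory is the closure of its literals, and it is
    determined by the set T of the letters it contains: T is generated from
    W by the defaults with positive consequent, and whenever such a default
    leads from T to a letter y outside T, the literal ~y is in W or is the
    consequent of a default that also fires from T. These sets are closed
    under union, so that the largest one avoiding given letters is a
    greatest fixed point, reached by discarding letters; this decides the
    entailment of a literal. Moreover, entailment of a literal depends only
    on the ancestors of its letter in the dependency graph, so the part of a
    witness set S lying in a strongly connected component that is minimal
    among those meeting S is again a witness set. Hence it suffices to try
    the witness sets with at most c elements.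

    For the time bound, data are trees in prefix notation on a tape used as
    a stack, where pairing two trees amounts to pushing one symbol.
    Functions on trees computable in polynomial time in this way are closed
    under composition, case distinction and folds with accumulators of
    polynomial size, and the decision procedure is made of these. *)

Set Implicit Arguments.
Unset Strict Implicit.
Unset Printing Implicit Defensive.

(** * Five-tape machines as multi-stack machines *)

Section Fragments.
Variable A : finType.

Local Notation char := (A + bool)%type.
Local Notation scan := ({ffun 'I_5 -> option char})%type.
Local Notation acts := ({ffun 'I_5 -> option char * move})%type.
Local Notation tapes := ({ffun 'I_5 -> tape char})%type.
Local Notation op := (option (option char))%type.

(** Since prerequisites are positive, a negative literal never enables a default, it only blocks. So
    T carries all the information: ~y is in the extension exactly when y is outside T and ~y can be
    concluded. The non-monotone blocking test becomes a choice of T; being derivable and being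
    negatable are then monotone in T. Closure under union rests on prerequisites being single
    letters: a default with a prerequisite that is applicable in a union is applicable in one of its
    members, and its condition can be charged to that letter. Conditions charged to no letter
    (facts, defaults without prerequisite) cannot be repaired by discarding letters and are tested
    on the final set. Entailment depends only on ancestors because a solution on an ancestor-closed
    set always continues to the other letters: there, positive consequents are given priority over
    negative ones. On the machine side, prefix notation is self-delimiting, so a counter finds the
    end of the top tree. A function has to work above arbitrary stack contents, so that data can
    wait below it. Sizes of results are bounded together with times, and for loops at every
    iteration, since iterating polynomial functions can produce exponential growth. *)

Record fragment := Fragment {
  fr_state : finType;
  fr_entry : fr_state;
  fr_trans : fr_state -> scan -> option fr_state * acts }.

Definition read (T : tapes) : scan := [ffun i => scanned (T i)].

Definition act (a : acts) (T : tapes) : tapes :=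
  [ffun i => move_tape (a i).2 (write_tape (a i).1 (T i))].

Inductive runs (F : fragment) : fr_state F -> tapes -> nat -> tapes -> Prop :=
| runs_exit x T a : fr_trans x (read T) = (None, a) -> runs x T 1 (act a T)
| runs_next x y T a n T' : fr_trans x (read T) = (Some y, a) ->
    runs y (act a T) n T' -> runs x T n.+1 T'.

Definition noop (s : scan) : acts := [ffun i => (s i, Stay)].

Lemma act_noop T : act (noop (read T)) T = T.
Proof. by apply/ffunP => i; rewrite !ffunE /=; case: (T i). Qed.

Lemma runs_map (F G : fragment) (h : fr_state F -> fr_state G) :
  (forall x s, fr_trans (h x) s =
     (omap h (fr_trans x s).1, (fr_trans x s).2)) ->
  forall x T n T', runs x T n T' -> runs (h x) T n T'.
Proof.
move=> hh x T n T'; elim=> {x T n T'} [x T a e|x y T a n T' e _ IH].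
  by apply: runs_exit; rewrite hh e.
by apply: runs_next IH; rewrite hh e.
Qed.

(** The last transition of F is redirected to z instead of exiting, so chaining two runs costs no
    extra step. *)
Lemma runs_map_next (F G : fragment) (h : fr_state F -> fr_state G) z :
  (forall x s, fr_trans (h x) s =
     (Some (oapp h z (fr_trans x s).1), (fr_trans x s).2)) ->
  forall x T n T' m T'',
    runs x T n T' -> runs z T' m T'' -> runs (h x) T (n + m) T''.
Proof.
move=> hh x T n T' m T'' r rz.
elim: r rz => {x T n T'} [x T a e|x y T a n T' e _ IH] rz.
  by rewrite add1n; apply: runs_next rz; rewrite hh e.
by rewrite addSn; apply: runs_next (IH rz); rewrite hh e.
Qed.

Definition seq_frag (F G : fragment) : fragment :=
  @Fragment (fr_state F + fr_state G)%type (inl (fr_entry F)) (fun x s =>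
    match x with
    | inl x => let r := fr_trans x s in
        (Some (if r.1 is Some y then inl y else inr (fr_entry G)), r.2)
    | inr x => let r := fr_trans x s in (omap inr r.1, r.2)
    end).

Definition if_frag (b : scan -> bool) (F G : fragment) : fragment :=
  @Fragment (option (fr_state F + fr_state G)) None (fun x s =>
    match x with
    | None => (Some (Some (if b s then inl (fr_entry F) else inr (fr_entry G))),
               noop s)
    | Some (inl x) => let r := fr_trans x s in (omap (Some \o inl) r.1, r.2)
    | Some (inr x) => let r := fr_trans x s in (omap (Some \o inr) r.1, r.2)
    end).

Definition while_frag (b : scan -> bool) (F : fragment) : fragment :=
  @Fragment (option (fr_state F)) None (fun x s =>
    match x with
    | None => (if b s then Some (Some (fr_entry F)) else None, noop s)
    | Some x => let r := fr_trans x s in (Some r.1, r.2)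
    end).

(* A push takes two steps, moving and then writing. *)
Definition ops_frag (f : scan -> 'I_5 -> op) : fragment :=
  @Fragment (option {ffun 'I_5 -> op}) None (fun x s =>
    match x with
    | None =>
      (Some (Some [ffun i => f s i]),
       [ffun i => (s i, if f s i is Some (Some _) then MoveRight else Stay)])
    | Some o =>
      (None,
       [ffun i => match o i with
                  | None => (s i, Stay)
                  | Some None =>
                      (s i, if i == ord0 then MoveRight else MoveLeft)
                  | Some (Some c) => (Some c, Stay)
                  end])
    end).

(* Tape 0 holds the unread part of the input; every other tape is a stack whose
   top is scanned, with a blank below its bottom. *)
Definition represents (T : tapes) (sg : 'I_5 -> seq char) : Prop :=
  [/\ scanned (T ord0) = ohead (sg ord0),
      rhs (T ord0) = behead (map Some (sg ord0))
    & forall i, i != ord0 ->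
        scanned (T i) :: lhs (T i) = rcons (map Some (sg i)) None].

Definition tops (sg : 'I_5 -> seq char) : scan := [ffun i => ohead (sg i)].

Lemma read_represents T sg : represents T sg -> read T = tops sg.
Proof.
case=> s0 _ si; apply/ffunP => i; rewrite !ffunE.
have [->//|/si] := eqVneq i ord0.
by case: (sg i) => [|c s] [].
Qed.

(** The step count is exact, so that times add up under composition; upper bounds enter only in
    [polytime_over]. *)
Definition computes F sg n sg' : Prop :=
  forall T, represents T sg ->
    exists2 T', runs (fr_entry F) T n T' & represents T' sg'.

Lemma computes_ext F sg n m sg1 sg2 :
  computes F sg n sg1 -> n = m -> sg1 =1 sg2 -> computes F sg m sg2.
Proof.
move=> h <- e T /h[T' r [h0 h1 h2]]; exists T' => //.
by split=> [||i /h2]; rewrite -?e.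
Qed.

Lemma computes_seq F G sg n sg1 m sg2 :
  computes F sg n sg1 -> computes G sg1 m sg2 ->
  computes (seq_frag F G) sg (n + m) sg2.
Proof.
move=> hF hG T /hF[T1 r1 /hG[T2 r2 h2]]; exists T2 => //.
apply: (@runs_map_next F (seq_frag F G) inl (inr (fr_entry G))) r1 _.
  by move=> x s /=; case: (fr_trans x s).1.
by apply: (@runs_map G (seq_frag F G) inr) r2.
Qed.

Lemma computes_if (b : scan -> bool) F G sg n sg' :
  computes (if b (tops sg) then F else G) sg n sg' ->
  computes (if_frag b F G) sg n.+1 sg'.
Proof.
move=> h T hT; have [T' r hT'] := h T hT; exists T' => //.
rewrite -(read_represents hT) in r; move: r; case: ifP => e r.
- apply: runs_next; first by rewrite /= e.
  by rewrite act_noop; apply: (@runs_map F (if_frag b F G) (Some \o inl)) r.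
- apply: runs_next; first by rewrite /= e.
  by rewrite act_noop; apply: (@runs_map G (if_frag b F G) (Some \o inr)) r.
Qed.

Lemma computes_while_end (b : scan -> bool) F sg :
  ~~ b (tops sg) -> computes (while_frag b F) sg 1 sg.
Proof.
move=> nb T hT; exists T => //=; rewrite -{2}[T]act_noop.
by apply: runs_exit; rewrite /= (read_represents hT) (negbTE nb).
Qed.

Lemma computes_while (b : scan -> bool) F sg n sg1 m sg2 :
  b (tops sg) -> computes F sg n sg1 -> computes (while_frag b F) sg1 m sg2 ->
  computes (while_frag b F) sg (n + m).+1 sg2.
Proof.
move=> bs hF hW T hT; have [T1 r1 /hW[T2 r2 h2]] := hF T hT; exists T2 => //.
rewrite -(read_represents hT) in bs.
apply: runs_next; first by rewrite /= bs.
rewrite act_noop.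
apply: (@runs_map_next F (while_frag b F) Some None) r1 r2.
by move=> x s /=; case: (fr_trans x s).1.
Qed.

Definition apply_op (o : op) (s : seq char) : seq char :=
  match o with
  | None => s
  | Some None => behead s
  | Some (Some c) => c :: s
  end.

(** A pop only moves the head and leaves the old symbol on its right. This is harmless: [represents]
    does not constrain that side of a stack, and a later push overwrites the cell. Popping an empty
    stack ends on another blank. The hypothesis keeps tape 0 read-only. *)
Lemma computes_ops (f : scan -> 'I_5 -> op) sg :
  (forall c, f (tops sg) ord0 != Some (Some c)) ->
  computes (ops_frag f) sg 2 (fun i => apply_op (f (tops sg) i) (sg i)).
Proof.
move=> f0 T hT; eexists.
  apply: runs_next; first by [].
  by apply: runs_exit.
rewrite (read_represents hT); set fs := f _ in f0 *.
case: hT => h0 h0' hi.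
have {f0} H : fs ord0 = None \/ fs ord0 = Some None.
  by case: (fs ord0) f0 => [[c /(_ c)/eqP|]|]; auto.
split.
- rewrite !ffunE eqxx; case: H => -> //=.
  by rewrite h0'; case: (sg ord0) => [|? []].
- rewrite !ffunE eqxx; case: H => -> //=.
  by rewrite h0'; case: (sg ord0) => [|? []].
- move=> i ni; have := hi i ni; rewrite !ffunE (negbTE ni).
  case: (fs i) => [[c|]|] //=; case: (T i) (sg i) => l a r [|d s] [-> ->] //.
  by case: s.
Qed.

End Fragments.

(** * Trees on the main stack *)

Inductive tree (A : Type) := Leaf of option A | Node of tree A & tree A.

Section Trees.
Variable A : finType.

Local Notation char := (A + bool)%type.
Local Notation scan := ({ffun 'I_5 -> option char})%type.
Local Notation op := (option (option char))%type.

Fixpoint word (t : tree A) : seq char :=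
  match t with
  | Leaf (Some a) => [:: inl a]
  | Leaf None => [:: inr false]
  | Node t1 t2 => inr true :: word t1 ++ word t2
  end.

Lemma word_neq0 t : 0 < size (word t).
Proof. by case: t => [[a|]|]. Qed.

Definition tape1 : 'I_5 := @Ordinal 5 1 isT.
Definition tape2 : 'I_5 := @Ordinal 5 2 isT.
Definition tape3 : 'I_5 := @Ordinal 5 3 isT.
Definition tape4 : 'I_5 := @Ordinal 5 4 isT.

Definition stacks (w s1 s2 s3 s4 : seq char) (i : 'I_5) : seq char :=
  nth [::] [:: w; s1; s2; s3; s4] i.

Lemma ord5_eq (T : Type) (f g : 'I_5 -> T) :
  f ord0 = g ord0 -> f tape1 = g tape1 -> f tape2 = g tape2 ->
  f tape3 = g tape3 -> f tape4 = g tape4 -> f =1 g.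
Proof.
move=> e0 e1 e2 e3 e4 [[|[|[|[|[|i]]]]] hi] //.
- by move: e0; congr (f _ = g _); apply: val_inj.
- by move: e1; congr (f _ = g _); apply: val_inj.
- by move: e2; congr (f _ = g _); apply: val_inj.
- by move: e3; congr (f _ = g _); apply: val_inj.
- by move: e4; congr (f _ = g _); apply: val_inj.
Qed.

Definition transfer (src : 'I_5) (dst : pred 'I_5) : fragment A :=
  while_frag (fun s => isSome (s src)) (ops_frag (fun s i =>
    if i == src then Some None else if dst i then Some (s src) else None)).

(** Each symbol costs one test and the two steps of [ops_frag]; the final failing test costs one
    more. *)
Lemma computes_transfer src (dst : pred 'I_5) sg :
  src != ord0 -> ~~ dst ord0 ->
  computes (transfer src dst) sg (3 * size (sg src) + 1) (fun i =>
    if i == src then [::] else if dst i then catrev (sg src) (sg i) else sg i).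
Proof.
move=> n0 d0; rewrite /transfer.
move e: (sg src) => s; elim: s sg e => [|c s IH] sg e.
  apply: computes_ext (computes_while_end _ _) _ _ => //.
    by rewrite ffunE e.
  by move=> i /=; case: eqP => [->|]; [|case: ifP].
apply: computes_ext (computes_while _ (computes_ops _) (IH _ _)) _ _ => /=.
- by rewrite ffunE e.
- by move=> c'; rewrite (eq_sym ord0) (negbTE n0) (negbTE d0).
- by rewrite eqxx /= e.
- lia.
- by move=> i /=; rewrite ffunE e; case: (i == src) => //=; case: (dst i).
Qed.

(* Tape 2 counts, in unary, the trees that remain to be read. *)
Definition move_trees (dst : 'I_5) : fragment A :=
  while_frag (fun s => isSome (s tape2)) (ops_frag (fun s i =>
    if i == tape1 then Some None
    else if i == tape2 then
      if s tape1 == Some (inr true) then Some (Some (inr true)) else Some None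
    else if i == dst then Some (s tape1) else None)).

(** The statement is about a forest because reading the root of a node replaces one pending tree by
    two. The induction is on the total length of the forest. *)
Lemma computes_move_trees dst ts sg s :
  dst != ord0 -> dst != tape1 -> dst != tape2 ->
  sg tape1 = flatten (map word ts) ++ s ->
  sg tape2 = nseq (size ts) (inr true) ->
  computes (move_trees dst) sg (3 * size (flatten (map word ts)) + 1) (fun i =>
    if i == tape1 then s else if i == tape2 then [::]
    else if i == dst then catrev (flatten (map word ts)) (sg i) else sg i).
Proof.
move=> n0 n1 n2; rewrite /move_trees.
have [n] := ubnP (size (flatten (map word ts))).
elim: n ts sg => // n IH [|t ts] sg le_n e1 e2.
  apply: computes_ext (computes_while_end _ _) _ _ => //.
    by rewrite ffunE e2.
  move=> i /=; case: eqP => [->|_]; first by rewrite e1.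
  by case: eqP => [->|_]; [rewrite e2|case: ifP].
have step := computes_while (sg := sg) _ (computes_ops _).
case: t le_n e1 e2 => [l|t1 t2] le_n e1 e2.
  have [c hc wc] : exists2 c, word (Leaf l) = [:: c] & c != inr true.
    by case: (l) => [a|]; eexists.
  move: hc le_n e1 => /= hc; rewrite hc /= => le_n e1.
  apply: computes_ext (step _ _ _ _ _ _ (IH ts _ _ _ _)) _ _ => /=.
  - by rewrite ffunE e2.
  - by move=> c'; rewrite (eq_sym ord0) (negbTE n0).
  - lia.
  - by rewrite e1.
  - rewrite ffunE e1 /=; case: eqP => [[E]|_ /=]; last by rewrite e2.
    by rewrite E eqxx in wc.
  - rewrite ?hc /=; lia.
  - move=> i /=; rewrite ffunE e1 /= ?hc.
    by case: (i == tape1) => //; case: (i == tape2) => //; case: (i == dst).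
apply: computes_ext (step _ _ _ _ _ _ (IH (t1 :: t2 :: ts) _ _ _ _)) _ _ => /=.
- by rewrite ffunE e2.
- by move=> c'; rewrite (eq_sym ord0) (negbTE n0).
- by move: le_n; rewrite /= !size_cat; lia.
- by rewrite e1 /= !catA.
- by rewrite ffunE e1 /= e2.
- by rewrite /= !size_cat; lia.
- move=> i /=; rewrite ffunE e1 /= catA.
  by case: (i == tape1) => //; case: (i == tape2) => //; case: (i == dst).
Qed.

Definition main (w s : seq char) : 'I_5 -> seq char :=
  stacks w s [::] [::] [::].

Definition push (i : 'I_5) (c : char) : fragment A :=
  ops_frag (fun _ j => if j == i then Some (Some c) else None).

Lemma computes_push i c sg : i != ord0 ->
  computes (push i c) sg 2 (fun j => if j == i then c :: sg j else sg j).
Proof.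
move=> n0; apply: computes_ext (computes_ops _) _ _ => //.
  by move=> c'; rewrite (eq_sym ord0) (negbTE n0).
by move=> j /=; case: eqP.
Qed.

Definition pop (i : 'I_5) : fragment A :=
  ops_frag (fun _ j => if j == i then Some None else None).

Lemma computes_pop i sg :
  computes (pop i) sg 2 (fun j => if j == i then behead (sg j) else sg j).
Proof.
apply: computes_ext (computes_ops _) _ _ => //.
  by move=> c'; case: ifP.
by move=> j /=; case: eqP.
Qed.

Definition move_tree dst := seq_frag (push tape2 (inr true)) (move_trees dst).

Lemma computes_move_tree dst t sg s :
  dst != ord0 -> dst != tape1 -> dst != tape2 ->
  sg tape1 = word t ++ s -> sg tape2 = [::] ->
  computes (move_tree dst) sg (3 * size (word t) + 3) (fun i =>
    if i == tape1 then s else if i == tape2 then [::]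
    else if i == dst then catrev (word t) (sg i) else sg i).
Proof.
move=> n0 n1 n2 e1 e2.
apply: computes_ext.
- apply: computes_seq; first exact: computes_push.
  apply: (computes_move_trees (ts := [:: t]) (s := s)) => //=.
  + by rewrite e1 cats0.
  + by rewrite e2.
- by rewrite /= cats0; lia.
- by apply: ord5_eq => //=; rewrite cats0 //; case: ifP => //; rewrite e2.
Qed.

Definition drop_frag : fragment A :=
  seq_frag (move_tree tape3) (transfer tape3 pred0).

(** Moving a tree to a scratch tape reverses its word, and moving it back restores it. The tree that
    was on top is put back first and ends below. *)
Definition swap_frag : fragment A :=
  seq_frag (move_tree tape3)
 (seq_frag (move_tree tape4)
 (seq_frag (transfer tape3 (pred1 tape1)) (transfer tape4 (pred1 tape1)))).

(** The copy left on tape 4 is in reading order, so it goes through tape 3 to be reversed before it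
    is pushed on the main stack. *)
Definition dup_frag : fragment A :=
  seq_frag (move_tree tape3)
 (seq_frag (transfer tape3 (pred2 tape1 tape4))
 (seq_frag (transfer tape4 (pred1 tape3)) (transfer tape3 (pred1 tape1)))).

Lemma computes_drop w t s :
  computes drop_frag (main w (word t ++ s)) (6 * size (word t) + 4) (main w s).
Proof.
apply: computes_ext.
- apply: computes_seq; first exact: computes_move_tree.
  exact: computes_transfer.
- rewrite /= !catrevE !(size_cat, size_rev) /=. lia.
- exact: ord5_eq.
Qed.

Lemma computes_swap w t1 t2 s :
  computes swap_frag (main w (word t1 ++ word t2 ++ s))
    (6 * (size (word t1) + size (word t2)) + 8)
    (main w (word t2 ++ word t1 ++ s)).
Proof.
apply: computes_ext.
- apply: computes_seq; first exact: computes_move_tree.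
  apply: computes_seq; first exact: computes_move_tree.
  apply: computes_seq; first exact: computes_transfer.
  exact: computes_transfer.
- by rewrite /= !catrevE !(size_cat, size_rev) /=; lia.
- by apply: ord5_eq => //=; rewrite !catrevE !cats0 ?revK.
Qed.

Lemma computes_dup w t s :
  computes dup_frag (main w (word t ++ s)) (12 * size (word t) + 6)
    (main w (word t ++ word t ++ s)).
Proof.
apply: computes_ext.
- apply: computes_seq; first exact: computes_move_tree.
  apply: computes_seq; first exact: computes_transfer.
  apply: computes_seq; first exact: computes_transfer.
  exact: computes_transfer.
- by rewrite /= !catrevE !(size_cat, size_rev) /=; lia.
- by apply: ord5_eq => //=; rewrite !catrevE ?cats0 ?revK.
Qed.

End Trees.

Arguments computes_drop {A} w t s.
Arguments computes_swap {A} w t1 t2 s.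
Arguments computes_dup {A} w t s.

(** * Polynomial-time functions on encodable data *)

(** One constant is both shift and exponent, so the bound is monotone in it and two bounds can be
    merged by taking a larger constant. *)
Definition polybounded (f : nat -> nat) : Prop :=
  exists c, forall n, f n <= (n + c) ^ c.

Lemma leq_pow_shift m n c d : m <= n -> c <= d -> (m + c) ^ c <= (n + d) ^ d.
Proof.
case: d => [|d] mn cd; first by move: cd; rewrite leqn0 => /eqP->.
apply: (@leq_trans ((n + d.+1) ^ c)); last by rewrite leq_pexp2l // addnS.
by case: c cd => // c cd; rewrite leq_exp2r // leq_add.
Qed.

Lemma polybounded_le f g :
  (forall n, f n <= g n) -> polybounded g -> polybounded f.
Proof. by move=> fg [c gc]; exists c => n; apply: leq_trans (gc n). Qed.

Lemma polybounded_const k : polybounded (fun=> k).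
Proof.
exists k.+1 => n; apply: (@leq_trans (n + k.+1)); first by lia.
by rewrite -{1}[n + _]expn1 leq_pexp2l // addnS.
Qed.

Lemma polybounded_id : polybounded id.
Proof. by exists 1 => n; rewrite expn1 leq_addr. Qed.

Lemma polybounded_comp f g :
  polybounded f -> polybounded g -> polybounded (f \o g).
Proof.
case=> c fc [d gd]; exists (c + d + 2 + (d + 2) * c) => n /=.
apply: (leq_trans (fc _)).
(* With m > 1 above n + d and c, the inner value is at most m ^ d.+1 + m ^ d.+1, hence at most m ^
   (d + 2). The constant chosen above dominates both the shift in m and the exponent (d + 2) * c. *)
set m := n + c + d + 2.
have m2 : 1 < m by rewrite /m; lia.
apply: (@leq_trans (m ^ ((d + 2) * c))).
  rewrite expnM; case: c @m m2 {fc} => [//|c] m m2; rewrite leq_exp2r //.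
  apply: (@leq_trans (m ^ d.+1 + m ^ d.+1)).
    apply: leq_add.
      apply: (leq_trans (gd n)); apply: (@leq_trans (m ^ d)).
        by case: d {gd} @m m2 => // d m m2; rewrite leq_exp2r // /m; lia.
      by rewrite leq_pexp2l // ltnW.
    apply: (@leq_trans (m ^ 1)); first by rewrite expn1 /m; lia.
    by rewrite leq_pexp2l // ltnW.
  rewrite addnn -mul2n (_ : d + 2 = d.+2) ?addn2 // (expnS m d.+1).
  by rewrite leq_mul2r m2 orbT.
apply: (@leq_trans ((n + (c + d + 2 + (d + 2) * c)) ^ ((d + 2) * c))).
  case: ((d + 2) * c) => // e; rewrite leq_exp2r // /m; lia.
by rewrite leq_pexp2l //; lia.
Qed.

Lemma polybounded_mul f g :
  polybounded f -> polybounded g -> polybounded (fun n => f n * g n).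
Proof.
case=> c fc [d gd]; exists (c + d) => n; rewrite expnD.
by apply: leq_mul; [apply: leq_trans (fc n) _|apply: leq_trans (gd n) _];
  [case: c {fc} => // c|case: d {gd} => // d]; rewrite leq_exp2r //; lia.
Qed.

Lemma polybounded_add f g :
  polybounded f -> polybounded g -> polybounded (fun n => f n + g n).
Proof.
case=> c fc [d gd].
have : polybounded (fun n => 2 * (n + (c + d)) ^ (c + d)).
  by apply: polybounded_mul; [apply: polybounded_const|exists (c + d)].
apply: polybounded_le => n; rewrite mul2n -addnn.
by apply: leq_add; [apply: leq_trans (fc n) _|apply: leq_trans (gd n) _];
  apply: leq_pow_shift => //; lia.
Qed.

Lemma polybounded_pow c : polybounded (fun n => (n + c) ^ c).
Proof. by exists c. Qed.

Create HintDb polybound.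
Hint Resolve polybounded_const polybounded_id polybounded_mul polybounded_add
  polybounded_pow : polybound.

Class encodable (A T : Type) := encode : T -> tree A.

(** Booleans, like options, are encoded as sequences with at most one element, so that their case
    distinctions reduce to the one on sequences. *)
Definition bool_seq (b : bool) : seq unit := nseq b tt.

Section Instances.
Variable A : Type.

#[export] Instance encodable_base : encodable A A := fun a => Leaf (Some a).
#[export] Instance encodable_unit : encodable A unit := fun=> Leaf None.
#[export] Instance encodable_prod T U `{encodable A T} `{encodable A U} :
  encodable A (T * U) := fun p => Node (encode p.1) (encode p.2).
(** A non-empty sequence has the same tree as the pair of its head and tail, so passing from one to
    the other leaves the stack unchanged. *)
#[export] Instance encodable_seq T `{encodable A T} : encodable A (seq T) :=
  foldr (fun x => Node (encode x)) (Leaf None).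
#[export] Instance encodable_bool : encodable A bool :=
  fun b => encode (bool_seq b).
#[export] Instance encodable_option T `{encodable A T} :
  encodable A (option T) := fun o => encode (seq_of_opt o).

End Instances.

Definition code_over (A : finType) T `{encodable A T} (x : T) :
  seq (A + bool) := word (encode x).

Arguments code_over A {T _} x.

(* The machine alphabet cannot be inferred from the type of the function. *)
Definition polytime_over (A : finType) X U `{encodable A X} `{encodable A U}
    (f : X -> U) : Prop :=
  exists (F : fragment A) (c : nat), forall x,
    size (code_over A (f x)) <= (size (code_over A x) + c) ^ c /\
    forall w s, exists2 n, n <= (size (code_over A x) + c) ^ c &
      computes F (main w (code_over A x ++ s)) n
        (main w (code_over A (f x) ++ s)).

Arguments polytime_over A {X U _ _} f.

Section Polytime.
Variable A : finType.
Local Notation code := (code_over A).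
Local Notation polytime := (polytime_over A).
Implicit Types (w s : seq (A + bool)).

Section Basics.
Context {X U : Type} `{encodable A X} `{encodable A U}.

Lemma polytimeI (F : fragment A) (B C : nat -> nat) (f : X -> U) :
  polybounded B -> polybounded C ->
  (forall x, size (code (f x)) <= B (size (code x))) ->
  (forall x w s, exists2 n, n <= C (size (code x)) &
    computes F (main w (code x ++ s)) n (main w (code (f x) ++ s))) ->
  polytime f.
Proof.
move=> [b Bb] [c Cc] fB fC; exists F, (b + c) => x; split=> [|w s].
  apply: leq_trans (fB x) (leq_trans (Bb _) _).
  by apply: leq_pow_shift => //; lia.
have [n le_n h] := fC x w s; exists n => //.
apply: leq_trans le_n (leq_trans (Cc _) _).
by apply: leq_pow_shift => //; lia.
Qed.

Arguments polytimeI F B C {f}.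

(** The time bound is restated for any upper bound m of the input size, since inside a composition
    only such a bound is known. *)
Lemma polytimeE (f : X -> U) : polytime f ->
  exists (F : fragment A) (c : nat), forall x,
    size (code (f x)) <= (size (code x) + c) ^ c /\
    forall m, size (code x) <= m -> forall w s, exists2 n, n <= (m + c) ^ c &
      computes F (main w (code x ++ s)) n (main w (code (f x) ++ s)).
Proof.
case=> F [c h]; exists F, c => x; have [h1 h2] := h x; split=> // m xm w s.
have [n le_n hn] := h2 w s; exists n => //.
by apply: leq_trans le_n _; apply: leq_pow_shift.
Qed.

Lemma polytime_ext (f g : X -> U) : f =1 g -> polytime f -> polytime g.
Proof. by move=> fg [F [c h]]; exists F, c => x; rewrite -fg. Qed.

Lemma polytime_reencode (f : X -> U) :
  (forall x, encode (f x) = encode x) -> polytime f.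
Proof.
move=> fE; apply: (polytimeI (ops_frag (fun _ _ => None)) id (fun=> 2)) => //.
- exact: polybounded_id.
- exact: polybounded_const.
- by move=> x; rewrite /code_over fE.
- move=> x w s; exists 2 => //; rewrite /code_over fE.
  by apply: computes_ext (computes_ops _) _ _.
Qed.

End Basics.

Arguments polytimeI {X U _ _} F B C {f}.

Lemma code_pair T U `{encodable A T} `{encodable A U} (x : T) (y : U) :
  code (x, y) = inr true :: code x ++ code y.
Proof. by []. Qed.

Lemma code_cons T `{encodable A T} (x : T) l :
  code (x :: l) = inr true :: code x ++ code l.
Proof. by []. Qed.

Lemma computes_push1 c w s :
  computes (push tape1 c) (main w s) 2 (main w (c :: s)).
Proof.
apply: computes_ext; [exact: computes_push|by []|exact: ord5_eq].
Qed.

Lemma computes_pop1 c w s :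
  computes (pop A tape1) (main w (c :: s)) 2 (main w s).
Proof. apply: computes_ext; [exact: computes_pop|by []|exact: ord5_eq]. Qed.

Arguments computes_push1 c w s : clear implicits.
Arguments computes_pop1 c w s : clear implicits.

Definition push_word (u : seq (A + bool)) : fragment A :=
  foldr (fun c F => seq_frag F (push tape1 c)) (ops_frag (fun _ _ => None)) u.

Lemma computes_push_word u w s :
  computes (push_word u) (main w s) (2 * size u + 2) (main w (u ++ s)).
Proof.
elim: u => [|c u IH] /=; first by apply: computes_ext (computes_ops _) _ _.
apply: computes_ext (computes_seq IH (computes_push1 c w _)) _ _ => //.
lia.
Qed.

Arguments computes_push_word u w s : clear implicits.

Section Combinators.
Context {X Y Z T S U : Type} `{encodable A X} `{encodable A Y} `{encodable A Z}
  `{encodable A T} `{encodable A S} `{encodable A U}.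

Lemma polytime_comp (g : Y -> Z) (f : X -> Y) :
  polytime g -> polytime f -> polytime (fun x => g (f x)).
Proof.
move=> /polytimeE[G [c hG]] [F [d hF]].
pose B n := ((n + d) ^ d + c) ^ c.
have pB : polybounded B.
  exact: (polybounded_comp (polybounded_pow c) (polybounded_pow d)).
apply: (polytimeI (seq_frag F G) B (fun n => (n + d) ^ d + B n)) => //.
- by apply: polybounded_add => //; apply: polybounded_pow.
- move=> x; apply: leq_trans (hG _).1 _; apply: leq_pow_shift => //.
  exact: (hF x).1.
- move=> x w s; have [_ hFx] := hF x; have [n le_n hn] := hFx w s.
  have [m le_m hm] := (hG (f x)).2 _ (hF x).1 w s.
  by exists (n + m); [rewrite leq_add|apply: computes_seq hn hm].
Qed.

(** The argument is duplicated; f consumes the upper copy while the other waits below. A swap brings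
    up the second copy for g, and another swap puts the results in order under a node symbol. *)
Lemma polytime_pair (f : X -> Y) (g : X -> Z) :
  polytime f -> polytime g -> polytime (fun x => (f x, g x)).
Proof.
move=> [F [c hF]] [G [d hG]].
pose B n := (n + c) ^ c + (n + d) ^ d + 1.
(* One duplication costs about 12 and each of the two swaps about 6 per symbol of the trees
   involved; 30 leaves room for all of them and the fixed steps. *)
pose C n := 30 * ((n + c) ^ c + (n + d) ^ d + n + 1).
apply: (polytimeI (seq_frag (dup_frag A) (seq_frag F (seq_frag (swap_frag A)
  (seq_frag G (seq_frag (swap_frag A) (push tape1 (inr true))))))) B C).
- by rewrite /B; auto with polybound.
- by rewrite /C; auto 10 with polybound.
- move=> x; rewrite code_pair /= size_cat /B addn1 ltnS.
  by rewrite leq_add ?(hF x).1 ?(hG x).1.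
- move=> x w s; have [sF hFx] := hF x; have [sG hGx] := hG x.
  have [n le_n hn] := hFx w (code x ++ s).
  have [m le_m hm] := hGx w (code (f x) ++ s).
  have hd := computes_dup w (encode x) s.
  have h1 := computes_swap w (encode (f x)) (encode x) s.
  have h2 := computes_swap w (encode (g x)) (encode (f x)) s.
  have h3 := computes_push1 (inr true) w (code (f x) ++ code (g x) ++ s).
  eexists; last first.
    rewrite code_pair /= -catA.
    apply: computes_seq; first exact: hd.
    apply: computes_seq; first exact: hn.
    apply: computes_seq; first exact: h1.
    apply: computes_seq; first exact: hm.
    by apply: computes_seq; [exact: h2|exact: h3].
  move: sF sG le_n le_m; rewrite /C /code_over; lia.
Qed.

Lemma polytime_fst0 : polytime (@fst X Y).
Proof.
apply: (polytimeI (seq_frag (pop A tape1) (seq_frag (swap_frag A)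
  (drop_frag A))) id (fun n => 30 * (n + 1))).
- by auto with polybound.
- by auto with polybound.
- by move=> [x y]; rewrite code_pair /= size_cat; lia.
- move=> [x y] w s; rewrite code_pair /= -catA; eexists; last first.
    apply: computes_seq; first exact: computes_pop1.
    apply: computes_seq; first exact: computes_swap.
    exact: computes_drop.
  by rewrite size_cat /code_over; lia.
Qed.

Lemma polytime_snd0 : polytime (@snd X Y).
Proof.
apply: (polytimeI (seq_frag (pop A tape1) (drop_frag A)) id
  (fun n => 30 * (n + 1))).
- by auto with polybound.
- by auto with polybound.
- by move=> [x y]; rewrite code_pair /= size_cat; lia.
- move=> [x y] w s; rewrite code_pair /= -catA; eexists; last first.
    apply: computes_seq; first exact: computes_pop1.
    exact: computes_drop.
  by rewrite size_cat /code_over; lia.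
Qed.

Lemma polytime_const (y : Y) : polytime (fun _ : X => y).
Proof.
apply: (polytimeI (seq_frag (drop_frag A) (push_word (code y)))
  (fun=> size (code y)) (fun n => 30 * (n + size (code y) + 1))).
- exact: polybounded_const.
- by auto with polybound.
- by [].
- move=> x w s; eexists; last first.
    apply: computes_seq; first exact: computes_drop.
    exact: computes_push_word.
  by rewrite /code_over; lia.
Qed.

Lemma polytime_base_pred (P : A -> bool) : polytime P.
Proof.
pose F u := seq_frag (pop A tape1) (push_word u).
apply: (polytimeI (if_frag (fun s : {ffun 'I_5 -> option (A + bool)} =>
  if s tape1 is Some (inl a) then P a else false)
  (F (code true)) (F (code false)))
  (fun=> 5) (fun=> 20)); try exact: polybounded_const.
- by move=> x; case: (P x).
- move=> a w s; eexists; last first.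
    apply: computes_if.
    rewrite ffunE /= (_ : (if P a then _ else _) = F (code (P a))).
      by apply: computes_seq; [exact: computes_pop1|exact: computes_push_word].
    by case: (P a).
  by case: (P a).
Qed.

(** Under the pairing symbol lies the root of the sequence. If it is a node, it is also the root of
    [(x, l)], so restoring the pairing symbol yields the argument of f. If it is a leaf, popping it
    leaves the argument of g. *)
Lemma polytime_case_seq (f : (T * seq T) * S -> U) (g : S -> U) :
  polytime f -> polytime g ->
  polytime (fun p : seq T * S =>
    if p.1 is x :: l then f ((x, l), p.2) else g p.2).
Proof.
move=> [F [c hF]] /polytimeE[G [d hG]].
pose B n := (n + c) ^ c + (n + d) ^ d.
apply: (polytimeI (seq_frag (pop A tape1)
  (if_frag (fun s : {ffun 'I_5 -> option (A + bool)} =>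
      s tape1 == Some (inr true))
    (seq_frag (push tape1 (inr true)) F) (seq_frag (pop A tape1) G)))
  B (fun n => B n + 10)).
- by rewrite /B; auto with polybound.
- by rewrite /B; auto with polybound.
- case=> [[|x l] s] /=; last first.
    by rewrite /B (leq_trans (hF _).1) // leq_addr.
  rewrite /B; apply: leq_trans (leq_trans (hG _).1 _) (leq_addl _ _).
  apply: leq_pow_shift => //; exact: leqW (leqW (leqnn _)).
- case=> [[|x l] s] w u; rewrite code_pair.
    have [|n le_n hn] := (hG s).2 (size (code ([::] : seq T, s))) _ w u.
      by rewrite code_pair /= -addn2 leq_addr.
    eexists; last first.
      apply: computes_seq; first exact: computes_pop1.
      apply: computes_if; rewrite ffunE /=.
      by apply: computes_seq hn; apply: computes_pop1.
    by move: le_n; rewrite /B code_pair; lia.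
  have [n le_n hn] := (hF ((x, l), s)).2 w u.
  eexists; last first.
    apply: computes_seq; first exact: computes_pop1.
    apply: computes_if; rewrite ffunE /=.
    by apply: computes_seq hn; apply: computes_push1.
  have e : size (inr true :: code (x :: l) ++ code s) = size (code ((x, l), s)).
    by [].
  move: le_n; rewrite e /B; lia.
Qed.

End Combinators.

Lemma polytime_id X `{encodable A X} : polytime (fun x : X => x).
Proof. exact: polytime_reencode. Qed.

Lemma polytime_fst X T U `{encodable A X} `{encodable A T} `{encodable A U}
  (f : X -> T * U) : polytime f -> polytime (fun x => (f x).1).
Proof. exact: (polytime_comp polytime_fst0). Qed.

Lemma polytime_snd X T U `{encodable A X} `{encodable A T} `{encodable A U}
  (f : X -> T * U) : polytime f -> polytime (fun x => (f x).2).
Proof. exact: (polytime_comp polytime_snd0). Qed.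

End Polytime.

Arguments polytimeI {A X U _ _} F B C {f}.

Ltac projections :=
  lazymatch goal with
  | |- polytime_over _ (fun x => x) => exact: polytime_id
  | |- polytime_over _ fst => exact: polytime_fst0
  | |- polytime_over _ snd => exact: polytime_snd0
  | |- polytime_over _ (fun x => (@?f x, @?g x)) =>
      apply: (polytime_pair (f := f) (g := g)); projections
  | |- polytime_over _ (fun x => (@?f x).1) =>
      apply: (polytime_fst (f := f)); projections
  | |- polytime_over _ (fun x => (@?f x).2) =>
      apply: (polytime_snd (f := f)); projections
  end.

(** * Loops over sequences *)

Section Loops.
Variable A : finType.
Local Notation code := (code_over A).
Local Notation polytime := (polytime_over A).

Lemma code_nil T `{encodable A T} : code ([::] : seq T) = [:: inr false].
Proof. by []. Qed.

Lemma code_base (a : A) : code a = [:: inl a].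
Proof. by []. Qed.

Lemma leq_size_code T `{encodable A T} (l : seq T) : size l < size (code l).
Proof.
elim: l => // x l IH; rewrite code_cons /= size_cat; apply: leq_trans IH _.
exact: leq_addl.
Qed.

(** Invariant: the remaining sequence lies above the accumulator. Prefixing a node symbol turns both
    into the code of [((x, l), s)], which is duplicated; F1 makes the new accumulator from one copy,
    F2 the new remaining sequence from the other. The bound M on all intermediate accumulators is
    assumed, as a bound for a single application of g does not give it. *)
Lemma computes_loop T S `{encodable A T} `{encodable A S} (g : T -> S -> S) :
  polytime (fun p : T * S => g p.1 p.2) ->
  exists (F : fragment A) (tau : nat -> nat), polybounded tau /\
    forall M w u l s, size (code l) <= M ->
      (forall i, size (code (foldl (fun s x => g x s) s (take i l))) <= M) ->
      exists2 n, n <= size l * tau M + 1 &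
        computes F (main w (code l ++ code s ++ u)) n
          (main w (code ([::] : seq T) ++
                   code (foldl (fun s x => g x s) s l) ++ u)).
Proof.
move=> hg.
have [F1 [c1 h1]] : polytime (fun p : (T * seq T) * S => g p.1.1 p.2).
  apply: (polytime_comp (f := fun p : (T * seq T) * S => (p.1.1, p.2)) hg).
  by projections.
have [F2 [c2 h2]] : polytime (fun p : (T * seq T) * S => p.1.2).
  by projections.
exists (while_frag (fun s => s tape1 == Some (inr true))
  (seq_frag (push tape1 (inr true)) (seq_frag (dup_frag A) (seq_frag F1
    (seq_frag (swap_frag A) F2))))).
(* One iteration works on [((x, l), s)], of size at most 2 * M + 1; the summand 100 * (M + 1) pays
   for the duplication, the swap and the fixed steps. *)
exists (fun M => 100 * (M + 1) + (2 * M + 1 + c1) ^ c1 + (2 * M + 1 + c2) ^ c2).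
split.
  have hp c : polybounded (fun M => (2 * M + 1 + c) ^ c).
    by apply: (polybounded_comp (polybounded_pow c)); auto with polybound.
  by auto 10 with polybound.
move=> M w u; elim=> [|x l IH] s hl hM.
  exists 1; first lia.
  by apply: computes_while_end; rewrite ffunE.
have hs := hM 0; rewrite take0 /= in hs.
have hs1 := hM 1; rewrite /= take0 /= in hs1.
have [|i|n le_n hn] := IH (g x s).
- by apply: leq_trans hl; rewrite code_cons /= size_cat leqW // leq_addl.
- by have := hM i.+1.
have e : code (x :: l) ++ code s ++ u = behead (code ((x, l), s)) ++ u.
  by rewrite code_pair catA.
have [_ h1x] := h1 ((x, l), s); have [_ h2x] := h2 ((x, l), s).
have [n1 le1 hn1] := h1x w (code ((x, l), s) ++ u).
have [n2 le2 hn2] := h2x w (code (g x s) ++ u).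
have sv : size (code ((x, l), s)) <= 2 * M + 1.
  have -> : size (code ((x, l), s)) = (size (code (x :: l) ++ code s)).+1 by [].
  by rewrite size_cat; lia.
have {}le1 : n1 <= (2 * M + 1 + c1) ^ c1.
  by apply: leq_trans le1 (leq_pow_shift _ _).
have {}le2 : n2 <= (2 * M + 1 + c2) ^ c2.
  by apply: leq_trans le2 (leq_pow_shift _ _).
eexists; last first.
  apply: computes_while; last exact: hn.
    by rewrite ffunE.
  apply: computes_seq; first exact: computes_push1.
  rewrite e.
  apply: computes_seq; first exact: (computes_dup w (encode ((x, l), s)) u).
  apply: computes_seq; first exact: hn1.
  apply: computes_seq.
    exact: (computes_swap w (encode (g x s)) (encode ((x, l), s)) u).
  exact: hn2.
move: sv hs1 le_n le1 le2; rewrite /code_over mulSn /=; lia.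
Qed.

Lemma polytime_foldl_closed X T S
    `{encodable A X} `{encodable A T} `{encodable A S}
    (g : T -> S -> S) (l : X -> seq T) (s0 : X -> S) B :
  polytime (fun p : T * S => g p.1 p.2) -> polytime l -> polytime s0 ->
  polybounded B ->
  (forall x i, size (code (foldl (fun s t => g t s) (s0 x) (take i (l x))))
     <= B (size (code x))) ->
  polytime (fun x => foldl (fun s t => g t s) (s0 x) (l x)).
Proof.
move=> /computes_loop[F [tau [ptau hF]]] hl hs0 pB hB.
have [G [c hG]] := polytime_pair hl hs0.
pose M n := (n + c) ^ c + B n.
have pM : polybounded M by rewrite /M; auto with polybound.
refine (polytimeI (seq_frag G (seq_frag (pop A tape1)
  (seq_frag F (pop A tape1)))) B
  (fun n => M n + M n * tau (M n) + 10) _ _ _ _) => //.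
- have ptM := polybounded_comp ptau pM.
  by rewrite /comp in ptM; auto 10 with polybound.
- by move=> x; have := hB x (size (l x)); rewrite take_size.
- move=> x w u.
  have [sG /(_ w u)[m le_m hm]] := hG x.
  have sl : size (l x) <= M (size (code x)).
    move: sG; rewrite code_pair /= size_cat /M.
    have : size (l x) < size (code (l x)) by exact: leq_size_code. lia.
  have [|i|n le_n hn] := hF (M (size (code x))) w u (l x) (s0 x).
  - move: sG; rewrite code_pair /= size_cat /M; lia.
  - by apply: leq_trans (hB x i) _; rewrite leq_addl.
  eexists; last first.
    apply: computes_seq; first exact: hm.
    rewrite code_pair /= -catA.
    apply: computes_seq; first exact: computes_pop1.
    apply: computes_seq; first exact: hn.
    exact: computes_pop1.
  have : size (l x) * tau (M (size (code x))) <=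
      M (size (code x)) * tau (M (size (code x))) by rewrite leq_mul2r sl orbT.
  have : m <= M (size (code x)) by apply: leq_trans le_m _; rewrite leq_addr.
  lia.
Qed.

(** The loop body sees only an element and the accumulator, so the parameter x travels inside the
    accumulator. *)
Lemma polytime_foldl X T S `{encodable A X} `{encodable A T} `{encodable A S}
    (g : X -> T -> S -> S) (l : X -> seq T) (s0 : X -> S) B :
  polytime (fun p : X * (T * S) => g p.1 p.2.1 p.2.2) ->
  polytime l -> polytime s0 -> polybounded B ->
  (forall x i, size (code (foldl (fun s t => g x t s) (s0 x) (take i (l x))))
     <= B (size (code x))) ->
  polytime (fun x => foldl (fun s t => g x t s) (s0 x) (l x)).
Proof.
move=> hg hl hs0 pB hB.
have foldE (x : X) (r : seq T) s :
    foldl (fun p t => (p.1, g p.1 t p.2)) (x, s) r =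
    (x, foldl (fun s t => g x t s) s r).
  by elim: r s => //= t r IH s; rewrite IH.
have hp : polytime (fun x => foldl
    (fun (p : X * S) t => (fun t p => (p.1, g p.1 t p.2)) t p)
    (x, s0 x) (l x)).
  refine (polytime_foldl_closed (B := fun n => n + B n + 1) _ _ _ _ _) => //.
  - apply: polytime_pair; first by projections.
    apply: (polytime_comp (f := fun p => (p.2.1, (p.1, p.2.2))) hg).
    by projections.
  - by apply: polytime_pair => //; apply: polytime_id.
  - by auto with polybound.
  - move=> x i; rewrite foldE code_pair /= size_cat addn1 ltnS leq_add2l.
    exact: hB.
apply: polytime_ext (polytime_snd hp) => x /=.
by rewrite foldE.
Qed.

End Loops.

(** * Sequences, case distinctions and booleans *)

Section Library.
Variable A : finType.
Local Notation code := (code_over A).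
Local Notation polytime := (polytime_over A).

Lemma polytime_recode X U V `{encodable A X} `{encodable A U} `{encodable A V}
    (f : X -> U) (g : X -> V) :
  (forall x, encode (f x) = encode (g x)) -> polytime g -> polytime f.
Proof.
by move=> e [F [c h]]; exists F, c => x; rewrite /code_over e; apply: h.
Qed.

Context {X T U : Type} `{encodable A X} `{encodable A T} `{encodable A U}.

Lemma polytime_cons (f : X -> T) (g : X -> seq T) :
  polytime f -> polytime g -> polytime (fun x => f x :: g x).
Proof.
move=> hf hg; have hp := polytime_pair hf hg.
exact: (polytime_recode (g := fun x => (f x, g x)) _ hp).
Qed.

Lemma polytime_seq_case (l : X -> seq T) (f : X -> T -> seq T -> U) g :
  polytime l -> polytime (fun p : X * (T * seq T) => f p.1 p.2.1 p.2.2) ->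
  polytime g ->
  polytime (fun x => if l x is y :: r then f x y r else g x).
Proof.
move=> hl hf hg.
have hf' : polytime (fun p : (T * seq T) * X => f p.2 p.1.1 p.1.2).
  apply: (polytime_comp
    (f := fun p : (T * seq T) * X => (p.2, (p.1.1, p.1.2))) hf).
  by projections.
have h1 := polytime_case_seq hf' hg.
have h2 : polytime (fun x => (l x, x)).
  by apply: polytime_pair => //; apply: polytime_id.
by apply: polytime_ext (polytime_comp h1 h2).
Qed.

Lemma polytime_weaken (f : X -> U) :
  polytime f -> polytime (fun p : X * T => f p.1).
Proof.
by move=> hf; apply: (polytime_comp (f := fun p => p.1) hf); projections.
Qed.

End Library.

Opaque code_over.

Section Booleans.
Variable A : finType.
Local Notation code := (code_over A).
Local Notation polytime := (polytime_over A).

Lemma polytime_if X U `{encodable A X} `{encodable A U}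
    (b : X -> bool) (f g : X -> U) :
  polytime b -> polytime f -> polytime g ->
  polytime (fun x => if b x then f x else g x).
Proof.
move=> hb hf hg.
have hs : polytime (fun x => bool_seq (b x)).
  exact: (polytime_recode (g := b)).
have := polytime_seq_case hs (f := fun x _ _ => f x)
  (polytime_weaken (T := unit * seq unit) hf) hg.
by apply: polytime_ext => x; case: (b x).
Qed.

Context {X T : Type} `{encodable A X} `{encodable A T}.

Lemma polytime_and (b c : X -> bool) :
  polytime b -> polytime c -> polytime (fun x => b x && c x).
Proof.
move=> hb hc; have := polytime_if hb hc (polytime_const false).
by apply: polytime_ext => x; case: (b x).
Qed.

Lemma polytime_or (b c : X -> bool) :
  polytime b -> polytime c -> polytime (fun x => b x || c x).
Proof.
move=> hb hc; have := polytime_if hb (polytime_const true) hc.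
by apply: polytime_ext => x; case: (b x).
Qed.

Lemma polytime_not (b : X -> bool) : polytime b -> polytime (fun x => ~~ b x).
Proof.
move=> hb.
have : polytime (fun x => if b x then false else true).
  by apply: polytime_if => //; apply: polytime_const.
by apply: polytime_ext => x; case: (b x).
Qed.

Lemma polytime_imply (b c : X -> bool) :
  polytime b -> polytime c -> polytime (fun x => b x ==> c x).
Proof.
move=> hb hc; have := polytime_if hb hc (polytime_const true).
by apply: polytime_ext => x; case: (b x).
Qed.

Lemma polytime_seq_of_opt (f : X -> option T) :
  polytime f -> polytime (fun x => seq_of_opt (f x)).
Proof. exact: polytime_recode. Qed.

Lemma polytime_of_seq (f : X -> option T) :
  polytime (fun x => seq_of_opt (f x)) -> polytime f.
Proof. exact: polytime_recode. Qed.

Lemma size_code_bool (b : bool) : size (code b) <= 3.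
Proof. by case: b. Qed.

Lemma size_code_drop i (l : seq T) : size (code (drop i l)) <= size (code l).
Proof.
elim: l i => [|x l IH] [|i] //; apply: leq_trans (IH i) _.
by rewrite code_cons /= size_cat; lia.
Qed.

Lemma size_code_take i (l : seq T) : size (code (take i l)) <= size (code l).
Proof.
elim: l i => [|x l IH] [|i] //; rewrite take_cons !code_cons /= !size_cat.
by rewrite ltnS leq_add2l.
Qed.

Lemma size_code_catrev (r s : seq T) :
  size (code (catrev r s)) + 1 = size (code r) + size (code s).
Proof.
elim: r s => [|t r IH] s /=; first by rewrite code_nil /= addnC.
by rewrite IH !code_cons /= !size_cat; lia.
Qed.

Lemma size_code_cat (r s : seq T) :
  size (code (r ++ s)) + 1 = size (code r) + size (code s).
Proof.
elim: r => [|t r IH] /=; first by rewrite code_nil /= addnC.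
by rewrite !code_cons /= !size_cat; lia.
Qed.

End Booleans.

(** * Right folds and the sequence functions built from them *)

Section Folds.
Variable A : finType.
Local Notation code := (code_over A).
Local Notation polytime := (polytime_over A).

Lemma polytime_rev X T `{encodable A X} `{encodable A T} (l : X -> seq T) :
  polytime l -> polytime (fun x => rev (l x)).
Proof.
move=> hl; have [c hc] : exists c, forall x,
    size (code (l x)) <= (size (code x) + c) ^ c.
  by case: hl => F [c h]; exists c => x; apply: (h x).1.
have foldE (s r : seq T) : foldl (fun s t => t :: s) s r = catrev r s.
  by elim: r s => //= x r IH s; rewrite IH.
have : polytime (fun x => foldl (fun s t => t :: s) ([::] : seq T) (l x)).
  refine (polytime_foldl (g := fun _ t s => t :: s) (s0 := fun=> [::])
    (B := fun n => (n + c) ^ c) _ hl _ _ _).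
  - apply: polytime_cons; projections.
  - exact: polytime_const.
  - exact: polybounded_pow.
  - move=> x i; rewrite foldE.
    apply: leq_trans _ (leq_trans (size_code_take i (l x)) (hc x)).
    by rewrite -(leq_add2r 1) size_code_catrev code_nil.
by apply: polytime_ext => x; rewrite foldE.
Qed.

Lemma polytime_size X U `{encodable A X} `{encodable A U} (f : X -> U) :
  polytime f ->
  exists2 B, polybounded B & forall x, size (code (f x)) <= B (size (code x)).
Proof.
case=> F [c h]; exists (fun n => (n + c) ^ c); first exact: polybounded_pow.
by move=> x; apply: (h x).1.
Qed.

(** This is a left fold over the reversed sequence. Prefixes of the reversal are reversed suffixes,
    hence [drop] in the size condition. *)
Lemma polytime_foldr X T S `{encodable A X} `{encodable A T} `{encodable A S}
    (g : X -> T -> S -> S) (l : X -> seq T) (s0 : X -> S) B :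
  polytime (fun p : X * (T * S) => g p.1 p.2.1 p.2.2) ->
  polytime l -> polytime s0 -> polybounded B ->
  (forall x i, size (code (foldr (g x) (s0 x) (drop i (l x))))
     <= B (size (code x))) ->
  polytime (fun x => foldr (g x) (s0 x) (l x)).
Proof.
move=> hg hl hs pB hB.
have : polytime (fun x => foldl (fun s t => g x t s) (s0 x) (rev (l x))).
  refine (polytime_foldl hg (polytime_rev hl) hs pB _) => x i.
  by rewrite take_rev foldl_rev.
by apply: polytime_ext => x; rewrite foldl_rev.
Qed.

Lemma polytime_map X T U `{encodable A X} `{encodable A T} `{encodable A U}
    (f : X -> T -> U) (l : X -> seq T) :
  polytime (fun p : X * T => f p.1 p.2) -> polytime l ->
  polytime (fun x => map (f x) (l x)).
Proof.
move=> hf hl.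
have [B pB hB] := polytime_size hl; have [F [c hF]] := hf.
(* The function f is applied fewer than B n times, to pairs of size at most n + B n + 1; the rest
   pays for the cells of the resulting sequence. *)
pose C n := B n * (n + B n + 1 + c) ^ c + B n + 1.
refine (polytime_foldr (g := fun x t acc => f x t :: acc) (s0 := fun=> [::])
  (B := C) _ hl _ _ _).
- apply: polytime_cons; last by projections.
  apply: (polytime_comp (f := fun p : X * (T * seq U) => (p.1, p.2.1)) hf).
  by projections.
- exact: polytime_const.
- have p1 : polybounded (fun n => (n + B n + 1 + c) ^ c).
    by apply: (polybounded_comp (polybounded_pow c)); auto with polybound.
  by rewrite /C; auto with polybound.
- move=> x i; set r := drop _ _.
  have hr : size (code r) <= B (size (code x)).
    exact: leq_trans (size_code_drop _ _) (hB x).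
  have : size (code (foldr (fun t acc => f x t :: acc) [::] r)) <=
     size (code r) * (size (code x) + B (size (code x)) + 1 + c) ^ c +
     size (code r) + 1.
    elim: r hr => [|t r IH] hr; first by rewrite /= !code_nil /=; lia.
    move: hr; rewrite /= !code_cons /= !size_cat => hr.
    have := IH (leq_trans (leq_addl _ _) (ltnW hr)).
    have : size (code (f x t)) <=
        (size (code x) + B (size (code x)) + 1 + c) ^ c.
      apply: leq_trans (hF (x, t)).1 (leq_pow_shift _ _) => //.
      rewrite code_pair /= size_cat; lia.
    set e := _ ^ c; nia.
  rewrite /C; set e := _ ^ c; set b := B _ in hr *; nia.
Qed.

Section Predicates.
Context {X T : Type} `{encodable A X} `{encodable A T}.
Variables (P : X -> T -> bool) (l : X -> seq T).
Hypotheses (hP : polytime (fun p : X * T => P p.1 p.2)) (hl : polytime l).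

Lemma polytime_under S `{encodable A S} :
  polytime (fun p : X * (T * S) => P p.1 p.2.1).
Proof.
apply: (polytime_comp (f := fun p : X * (T * S) => (p.1, p.2.1)) hP).
by projections.
Qed.

Lemma polytime_filter : polytime (fun x => filter (P x) (l x)).
Proof.
have [B pB hB] := polytime_size hl.
have filterE x r :
    foldr (fun t acc => if P x t then t :: acc else acc) [::] r =
    filter (P x) r.
  by elim: r => //= t r ->.
have : polytime (fun x =>
    foldr (fun t acc => if P x t then t :: acc else acc) [::] (l x)).
  refine (polytime_foldr (s0 := fun=> [::]) (B := B)
    (g := fun x t acc => if P x t then t :: acc else acc) _ hl _ _ _) => //.
  - apply: polytime_if; first exact: polytime_under.
    + by apply: polytime_cons; projections.
    + by projections.
  - exact: polytime_const.
  - move=> x i; rewrite filterE.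
    apply: leq_trans _ (leq_trans (size_code_drop i (l x)) (hB x)).
    elim: (drop i (l x)) => //= t r IH.
    by case: (P x t); rewrite !code_cons /= !size_cat; lia.
by apply: polytime_ext => x; rewrite filterE.
Qed.

Lemma polytime_has : polytime (fun x => has (P x) (l x)).
Proof.
have : polytime (fun x => foldr (fun t b => P x t || b) false (l x)).
  refine (polytime_foldr (s0 := fun=> false) (B := fun=> 3)
    (g := fun x t b => P x t || b) _ hl _ _ _) => //.
  - by apply: polytime_or; [apply: polytime_under|projections].
  - exact: polytime_const.
  - exact: polybounded_const.
  - by move=> x i; apply: size_code_bool.
by apply: polytime_ext => x; elim: (l x) => //= t r ->.
Qed.

Lemma polytime_all : polytime (fun x => all (P x) (l x)).
Proof.
have : polytime (fun x => foldr (fun t b => P x t && b) true (l x)).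
  refine (polytime_foldr (s0 := fun=> true) (B := fun=> 3)
    (g := fun x t b => P x t && b) _ hl _ _ _) => //.
  - by apply: polytime_and; [apply: polytime_under|projections].
  - exact: polytime_const.
  - exact: polybounded_const.
  - by move=> x i; apply: size_code_bool.
by apply: polytime_ext => x; elim: (l x) => //= t r ->.
Qed.

End Predicates.

Section Sequences.
Context {X T S : Type} `{encodable A X} `{encodable A T} `{encodable A S}.

Lemma polytime_cat (l r : X -> seq T) :
  polytime l -> polytime r -> polytime (fun x => l x ++ r x).
Proof.
move=> hl hr.
have [B pB hB] := polytime_size hl; have [C pC hC] := polytime_size hr.
have catE (u v : seq T) : foldr (fun t s => t :: s) v u = u ++ v.
  by elim: u => //= t u ->.
have : polytime (fun x => foldr (fun t s => t :: s) (r x) (l x)).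
  refine (polytime_foldr (g := fun _ t s => t :: s) (B := fun n => B n + C n)
    _ hl hr _ _).
  - by apply: polytime_cons; projections.
  - by auto with polybound.
  - move=> x i; rewrite catE; apply: leq_trans (leq_addr 1 _) _.
    by rewrite size_code_cat leq_add // (leq_trans (size_code_drop _ _)).
by apply: polytime_ext => x; rewrite catE.
Qed.

(** The sequence serves only as a unary clock. *)
Lemma polytime_iter (g : X -> S -> S) (l : X -> seq T) (s0 : X -> S) B :
  polytime (fun p : X * S => g p.1 p.2) -> polytime l -> polytime s0 ->
  polybounded B ->
  (forall x i, size (code (iter i (g x) (s0 x))) <= B (size (code x))) ->
  polytime (fun x => iter (size (l x)) (g x) (s0 x)).
Proof.
move=> hg hl hs pB hB.
have iterE x r :
    foldr (fun (_ : T) s => g x s) (s0 x) r = iter (size r) (g x) (s0 x).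
  by elim: r => //= t r ->.
have : polytime (fun x => foldr (fun (_ : T) s => g x s) (s0 x) (l x)).
  refine (polytime_foldr (g := fun x _ s => g x s) _ hl hs pB _).
  - apply: (polytime_comp (f := fun p : X * (T * S) => (p.1, p.2.2)) hg).
    by projections.
  - by move=> x i; rewrite iterE.
by apply: polytime_ext => x; rewrite iterE.
Qed.

Lemma polytime_behead (l : X -> seq T) :
  polytime l -> polytime (fun x => behead (l x)).
Proof.
move=> hl.
apply: (polytime_seq_case (f := fun _ _ r => r) (g := fun=> [::])) => //.
- by projections.
- exact: polytime_const.
Qed.

Lemma polytime_nilp (l : X -> seq T) :
  polytime l -> polytime (fun x => nilp (l x)).
Proof.
move=> hl.
have : polytime (fun x => if l x is _ :: _ then false else true).
  by apply: (polytime_seq_case (f := fun _ _ _ => false)) => //;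
    apply: polytime_const.
by apply: polytime_ext => x; case: (l x).
Qed.

Lemma polytime_head (z : T) (l : X -> seq T) :
  polytime l -> polytime (fun x => head z (l x)).
Proof.
move=> hl.
apply: (polytime_seq_case (f := fun _ t _ => t) (g := fun=> z)) => //.
- by projections.
- exact: polytime_const.
Qed.

Lemma polytime_drop n (l : X -> seq T) :
  polytime l -> polytime (fun x => drop n (l x)).
Proof.
move=> hl; elim: n => [|n IH].
  by apply: polytime_ext hl => x; rewrite drop0.
have : polytime (fun x => if drop n (l x) is _ :: r then r else [::]).
  apply: (polytime_seq_case (f := fun _ _ r => r) (g := fun=> [::])) => //.
  - by projections.
  - exact: polytime_const.
apply: polytime_ext => x.
by elim: n (l x) {IH} => [|n IH] [|t r] //=; rewrite ?drop0.
Qed.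

End Sequences.

End Folds.

Section Flatten.
Variable A : finType.
Local Notation code := (code_over A).
Local Notation polytime := (polytime_over A).
Context {X T : Type} `{encodable A X} `{encodable A T}.

Lemma polytime_flatten (l : X -> seq (seq T)) :
  polytime l -> polytime (fun x => flatten (l x)).
Proof.
move=> hl; have [B pB hB] := polytime_size hl.
refine (polytime_foldr (g := fun _ t s => t ++ s) (s0 := fun=> [::])
  (B := B) _ hl _ pB _).
- by apply: polytime_cat; projections.
- exact: polytime_const.
- move=> x i; rewrite -/(flatten _).
  apply: leq_trans _ (leq_trans (size_code_drop i (l x)) (hB x)).
  elim: (drop i (l x)) => [|t r IH]; first by rewrite /= !code_nil.
  rewrite (_ : flatten (t :: r) = t ++ flatten r) //.
  by rewrite -(leq_add2r 1) size_code_cat code_cons /= size_cat; lia.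
Qed.

End Flatten.

(** * Equality tests *)

Definition polytime_eq_over (A : finType) (T : eqType) `{encodable A T} :=
  polytime_over A (fun p : T * T => p.1 == p.2).

Arguments polytime_eq_over A T {_}.

Section Equality.
Variable A : finType.
Local Notation code := (code_over A).
Local Notation polytime := (polytime_over A).
Local Notation polytime_eq := (polytime_eq_over A).

Lemma polytime_eqop X (T : eqType) `{encodable A X} `{encodable A T}
    (f g : X -> T) :
  polytime_eq T -> polytime f -> polytime g -> polytime (fun x => f x == g x).
Proof.
by move=> hT hf hg; apply: (polytime_comp (f := fun x => (f x, g x)) hT);
  apply: polytime_pair.
Qed.

Lemma polytime_eq_base : polytime_eq (A : eqType).
Proof.
have : forall e : seq A,
    polytime (fun p : A * A => has (fun c => (p.1 == c) && (p.2 == c)) e).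
  elim=> [|c e IH] /=; first exact: polytime_const.
  have hc : polytime (fun a : A => a == c) by apply: polytime_base_pred.
  apply: polytime_or => //; apply: polytime_and.
    by apply: (polytime_comp (f := fun p : A * A => p.1) hc); projections.
  by apply: (polytime_comp (f := fun p : A * A => p.2) hc); projections.
move=> /(_ (enum A)); apply: polytime_ext => -[x y] /=.
apply/hasP/eqP => [[c _ /andP[/eqP-> /eqP->]] //|<-].
by exists x; rewrite ?mem_enum // eqxx.
Qed.

Lemma polytime_eq_bool : polytime_eq bool.
Proof.
have : polytime (fun p : bool * bool => if p.1 then p.2 else ~~ p.2).
  by apply: polytime_if; [..|apply: polytime_not]; projections.
by apply: polytime_ext => -[[] []].
Qed.

Lemma polytime_eq_pair (T U : eqType) `{encodable A T} `{encodable A U} :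
  polytime_eq T -> polytime_eq U -> polytime_eq (T * U)%type.
Proof.
move=> hT hU.
have : polytime (fun p : (T * U) * (T * U) =>
    (p.1.1 == p.2.1) && (p.1.2 == p.2.2)).
  by apply: polytime_and; apply: polytime_eqop => //; projections.
by apply: polytime_ext => -[[x y] [z t]].
Qed.

(** One pass over the first sequence, carrying the verdict so far and the unread part of the second.
    The sequences agree when the verdict is still true and nothing is left to read. *)
Lemma polytime_eq_seq (T : eqType) `{encodable A T} :
  polytime_eq T -> polytime_eq (seq T).
Proof.
move=> hT.
pose g (x : T) (p : bool * seq T) :=
  if p.2 is y :: r then (p.1 && (x == y), r) else (false, [::]).
have gE (s t : seq T) b :
    let p := foldl (fun p x => g x p) (b, t) s in
    (p.1 && nilp p.2 = b && (s == t)) /\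
    size (code p.2) <= size (code t).
  elim: s t b => [|x s IH] [|y t] b /=.
  - by rewrite andbT.
  - by rewrite andbF.
  - by have [-> ->] := IH [::] false; rewrite andbF.
  - have [-> h] := IH t (b && (x == y)); rewrite eqseq_cons andbA; split=> //.
    by apply: leq_trans h _; rewrite code_cons /= size_cat; lia.
have : polytime (fun p : seq T * seq T =>
    let q := foldl (fun q x => g x q) (true, p.2) p.1 in q.1 && nilp q.2).
  have h : polytime (fun p : seq T * seq T =>
      foldl (fun q x => g x q) (true, p.2) p.1).
    refine (polytime_foldl (g := fun _ => g) (s0 := fun p => (true, p.2))
      (B := fun n => n + 10) _ _ _ _ _).
    + apply: (polytime_seq_case (l := fun p : _ * (_ * (_ * _)) => p.2.2.2)
        (g := fun=> (false, [::]))
        (f := fun p y r => (p.2.2.1 && (p.2.1 == y), r))).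
      * by projections.
      * apply: polytime_pair; last by projections.
        apply: polytime_and; first by projections.
        by apply: polytime_eqop => //; projections.
      * exact: polytime_const.
    + by projections.
    + by apply: polytime_pair; [apply: polytime_const|projections].
    + by auto with polybound.
    + move=> [s t] i /=; set q := foldl _ _ _.
      have [_] := gE (take i s) t true; rewrite -/q; case: q => b r /= h.
      have : size (code b) <= 3 by exact: size_code_bool.
      by rewrite !code_pair /= !size_cat; lia.
  apply: polytime_and; first exact: (polytime_fst h).
  exact: (polytime_nilp (polytime_snd h)).
by apply: polytime_ext => -[s t] /=; rewrite (gE s t true).1.
Qed.

Lemma polytime_eq_option (T : eqType) `{encodable A T} :
  polytime_eq T -> polytime_eq (option T).
Proof.
move=> /polytime_eq_seq hT.
have : polytime (fun p : option T * option T =>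
    seq_of_opt p.1 == seq_of_opt p.2).
  by apply: polytime_eqop => //; apply: polytime_seq_of_opt; projections.
apply: polytime_ext => -[[x|] [y|]] //=.
by rewrite eqseq_cons andbT.
Qed.

Lemma polytime_mem X (T : eqType) `{encodable A X} `{encodable A T}
    (f : X -> T) (l : X -> seq T) :
  polytime_eq T -> polytime f -> polytime l -> polytime (fun x => f x \in l x).
Proof.
move=> hT hf hl.
have : polytime (fun x => has (fun t => t == f x) (l x)).
  apply: (polytime_has (P := fun x t => t == f x)) => //.
  apply: polytime_eqop => //; first by projections.
  exact: polytime_weaken.
by apply: polytime_ext => x; rewrite has_pred1.
Qed.

Lemma polytime_undup X (T : eqType) `{encodable A X} `{encodable A T}
    (l : X -> seq T) :
  polytime_eq T -> polytime l -> polytime (fun x => undup (l x)).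
Proof.
move=> hT hl; have [B pB hB] := polytime_size hl.
pose g (t : T) s := if t \in s then s else t :: s.
have gE s : foldr g [::] s = undup s.
  by elim: s => //= t s ->; rewrite /g mem_undup.
have : polytime (fun x => foldr g [::] (l x)).
  refine (polytime_foldr (g := fun _ => g) (s0 := fun=> [::]) _ hl _ pB _).
  - apply: polytime_if.
    + by apply: polytime_mem => //; projections.
    + by projections.
    + by apply: polytime_cons; projections.
  - exact: polytime_const.
  - move=> x i; rewrite gE.
    apply: leq_trans _ (leq_trans (size_code_drop i (l x)) (hB x)).
    elim: (drop i (l x)) => //= t r IH.
    by case: (t \in r); rewrite !code_cons /= !size_cat; lia.
by apply: polytime_ext => x; rewrite gE.
Qed.

End Equality.

(** * From polynomial-time functions to Turing machines *)

Lemma polybounded_monomial f : polybounded f ->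
  exists a k, forall n, f n <= a * n ^ k + a.
Proof.
(* For n > 0 one has n + c <= c.+1 * n; the additive copy of the coefficient covers n = 0. *)
case=> c fc; exists (c.+1 ^ c), c => n; apply: leq_trans (fc n) _.
case: n => [|n].
  apply: leq_trans (leq_addl _ _).
  by case: c {fc} => // c; rewrite leq_exp2r.
apply: leq_trans (leq_addr _ _); rewrite -expnMn.
by case: c {fc} => // c; rewrite leq_exp2r // mulSn; nia.
Qed.

Section Machine.
Variable A : finType.
Local Notation code := (code_over A).
Local Notation polytime := (polytime_over A).

(* The verdict is the root of the tree on the main stack, as [true] is encoded
   by a node and [false] by a leaf. *)
Definition fragment_machine (F : fragment A) : turing_machine A :=
  @TuringMachine A 4 bool (fr_state F + option bool)%type (inl (fr_entry F))
    (fun q => if q is inr (Some b) then Some b else None)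
    (fun q s =>
      match q with
      | inl x => let r := fr_trans x s in
          (if r.1 is Some y then inl y else inr None, r.2)
      | inr _ => (inr (Some (s tape1 == Some (inr true))), noop s)
      end).

Lemma iter_step_runs (F : fragment A) x T n T' : runs x T n T' ->
  iter n (@step A (fragment_machine F))
    (@Config A (fragment_machine F) (inl x) T)
    = @Config A (fragment_machine F) (inr None) T'.
Proof.
elim=> {x T n T'} [x T a e|x y T a n T' e _ IH].
  by rewrite /= /step /= -/(read T) e.
rewrite iterSr -IH; congr (iter n _ _).
by rewrite /step /= -/(read T) e.
Qed.

Lemma step_halted (M : turing_machine A) w n m b : n <= m ->
  halts_within M w n b -> halts_within M w m b.
Proof.
move=> /subnK <-; rewrite /halts_within iterD; set cf := iter n _ _ => h.
suff -> : iter (m - n) (@step A M) cf = cf by [].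
by elim: (m - n) => //= k ->; rewrite /step h.
Qed.

Definition load_loop : fragment A :=
  while_frag (fun s => isSome (s ord0))
    (seq_frag (ops_frag (fun s i => if i == ord0 then Some None
                                    else if i == tape1 then Some (s ord0)
                                    else None))
      (push tape1 (inr true))).

Lemma computes_load_loop (w l : seq A) :
  computes load_loop (main [seq inl a | a <- w] (code l)) (5 * size w + 1)
    (main [::] (code (catrev w l))).
Proof.
elim: w l => [|a w IH] l.
  by apply: computes_while_end; rewrite ffunE.
have h : computes (seq_frag (ops_frag (fun s i => if i == ord0 then Some None
                                    else if i == tape1 then Some (s ord0)
                                    else None))
      (push tape1 (inr true))) (main [seq inl a | a <- a :: w] (code l)) 4
      (main [seq inl a | a <- w] (code (a :: l))).
  apply: computes_ext.
  - apply: computes_seq; last exact: computes_push.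
    by apply: computes_ops => c; rewrite eqxx.
  - by [].
  - by apply: ord5_eq => //=; rewrite ffunE code_cons code_base.
apply: computes_ext.
- apply: computes_while; [|exact: h|exact: (IH (a :: l))].
  by rewrite ffunE.
- by rewrite /=; lia.
- by [].
Qed.

(** Each input symbol is put in front of a sequence that starts empty, so the word arrives reversed;
    [in_P_polytime] compensates by composing with [rev]. *)
Definition load : fragment A := seq_frag (push tape1 (inr false)) load_loop.

Lemma computes_load (w : seq A) :
  computes load (main [seq inl a | a <- w] [::]) (5 * size w + 3)
    (main [::] (code (rev w))).
Proof.
have h0 : computes (push tape1 (inr false)) (main [seq inl a | a <- w] [::]) 2
    (main [seq inl a | a <- w] (code ([::] : seq A))).
  by rewrite code_nil; apply: computes_push1.
apply: computes_ext.
- by apply: computes_seq; [exact: h0|exact: computes_load_loop].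
- lia.
- by [].
Qed.

Lemma size_code_base (w : seq A) : size (code w) = 2 * size w + 1.
Proof.
elim: w => [|a w IH]; first by rewrite code_nil.
rewrite code_cons /= size_cat IH.
rewrite code_base /=; lia.
Qed.

Lemma in_P_polytime (f : seq A -> bool) :
  polytime f -> in_P [set w | f w]%classic.
Proof.
move=> hf.
have hrev : polytime (fun w : seq A => rev w).
  by apply: polytime_rev; apply: polytime_id.
have [F [c hF]] := polytime_comp hf hrev.
(* Loading takes 5 * n + 3 steps and the verdict one more; the code of a word of length n has 2 * n
   + 1 symbols. *)
pose B n := 5 * n + 4 + (2 * n + 1 + c) ^ c.
have [a [k hB]] : exists a k, forall n, B n <= a * n ^ k + a.
  apply: polybounded_monomial; rewrite /B.
  have := polybounded_comp (polybounded_pow c) (g := fun n => 2 * n + 1).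
  by move=> hp; apply: polybounded_add; [|apply: hp]; auto with polybound.
exists (fragment_machine (seq_frag load F)), a, k => w.
have [_ /(_ [::] [::])[n le_n hn]] := hF (rev w).
have hw : computes (seq_frag load F) (main [seq inl a | a <- w] [::])
    (5 * size w + 3 + n) (main [::] (code (f w))).
  apply: computes_seq; first exact: computes_load.
  by move: hn; rewrite !cats0 revK.
set M := fragment_machine _.
have [|T' hT' [_ _ hr]] := hw (cf_tapes (init_config M w)).
  split; rewrite ?ffunE ?eqxx /=.
  - by case: w {hn le_n hw}.
  - by case: w {hn le_n hw} => //= ? w; rewrite -map_comp.
  - move=> i ni; rewrite !ffunE (negbTE ni) /=.
    by case: i ni => [[|[|[|[|[|i]]]]] hi].
exists (f w); last by [].
apply: (@step_halted _ _ (5 * size w + 3 + n).+1).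
  apply: leq_trans (hB (size w)); rewrite /B.
  move: le_n; rewrite size_code_base size_rev; lia.
rewrite /halts_within iterS.
have -> : iter (5 * size w + 3 + n) (@step A M) (init_config M w) =
    @Config A M (inr None) T'.
  exact: (iter_step_runs hT').
rewrite /step /= ffunE.
have := hr tape1 isT; rewrite /main /stacks /=.
by case: (f w) => -[-> _].
Qed.

End Machine.

(** * Extensions and their positive letters *)

Definition lits (X : literal -> Prop) : set formula :=
  [set f | exists2 l, X l & f = lit_formula l]%classic.

Definition coherent (X : literal -> Prop) : Prop :=
  forall a, X (true, a) -> X (false, a) -> False.

Lemma holds_lit v l : holds v (lit_formula l) = (v l.2 == l.1).
Proof. by case: l => [[] a] /=; case: (v a). Qed.

Lemma closure_sub (X : set formula) f : X f -> logical_closure X f.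
Proof. by move=> Xf v hv; apply: hv. Qed.

Lemma closure_le (X Y : set formula) :
  (forall f, X f -> logical_closure Y f) ->
  forall f, logical_closure X f -> logical_closure Y f.
Proof. by move=> XY f Xf v hv; apply: Xf => g /XY; apply. Qed.

Lemma closure_lits X l : coherent X ->
  logical_closure (lits X) (lit_formula l) <-> X l.
Proof.
move=> cX; split=> [cl|Xl]; last by apply: closure_sub; exists l.
apply: boolp.contrapT => nX.
(* This valuation falsifies l and follows X elsewhere. The only literal of X that could conflict on
   the letter of l is the negation of l, which it satisfies. *)
pose v a := if a == l.2 then ~~ l.1 else boolp.asbool (X (true, a)).
suff : holds v (lit_formula l) by rewrite holds_lit /v eqxx; case: (l.1).
apply: cl => _ [k Xk ->]; rewrite holds_lit /v.
case: (k.2 =P l.2) => [e|_].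
  case: l k e nX Xk {v} => [b a] [b' a'] /= -> nX Xk.
  by case: b b' nX Xk => [] [] nX Xk.
case: k Xk => [[] a] Xk /=; rewrite ?eqb_id //.
  by apply/boolp.asboolP.
by apply/eqP; apply/boolp.asboolPn => Xa; apply: cX Xa Xk.
Qed.

Lemma consistentP W : consistent (lit_set W) <-> coherent (fun l => l \in W).
Proof.
split=> [cW a Wa Wna|cW h].
  apply: cW => v hv.
  have hW l : l \in W -> v l.2 == l.1.
    by move=> Wl; rewrite -holds_lit; apply: hv; exists l.
  by have := hW _ Wa; rewrite (eqP (hW _ Wna)).
have h0 l : l \in W.
  by apply/(closure_lits l cW) => v hv; have := h v hv.
exact: (cW [::] (h0 _) (h0 _)).
Qed.

Section Extensions.
Variables (D : seq default).

Definition applicable (T : letter -> Prop) (d : default) : Prop :=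
  forall p, d.1 = Some p -> T p.

Section Facts.
Variable W : seq literal.

(** Being inductive, it expresses groundedness in W. The restriction to T replaces the consistency
    check of the defaults: a letter of T has no negation in the extension. *)
Inductive derivable (T : letter -> Prop) : letter -> Prop :=
| derivable_fact a : (true, a) \in W -> T a -> derivable T a
| derivable_default d a : d \in D -> d.2 = (true, a) -> T a ->
    (forall p, d.1 = Some p -> derivable T p) -> derivable T a.

Definition negatable (T : letter -> Prop) (y : letter) : Prop :=
  (false, y) \in W \/
  exists d, [/\ d \in D, d.2 = (false, y) & applicable T d].

(* The sets of letters that hold in some extension. *)
Record positive_part (T : letter -> Prop) : Prop := PositivePart {
  positive_fact : forall a, (true, a) \in W -> T a;
  positive_negated : forall a, (false, a) \in W -> ~ T a;
  positive_derivable : forall a, T a -> derivable T a;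
  positive_closed : forall d, d \in D -> d.2.1 -> applicable T d ->
    T d.2.2 \/ negatable T d.2.2 }.

(** A default for ~y is blocked exactly by y, so the negative literals of the extension are read off
    from T. *)
Definition concluded (T : letter -> Prop) (l : literal) : Prop :=
  if l.1 then T l.2 else ~ T l.2 /\ negatable T l.2.

Lemma coherent_concluded T : coherent (concluded T).
Proof. by move=> a Ta [nTa _]. Qed.

Lemma stage_mono E i j f : i <= j -> stage D W E i f -> stage D W E j f.
Proof.
move=> /subnK <-; elim: (j - i) => // k IH h; rewrite addSn.
by left; apply: closure_sub; apply: IH.
Qed.

Lemma extension_concluded T :
  positive_part T -> is_extension D W (logical_closure (lits (concluded T))).
Proof.
move=> vT; set E := logical_closure _.
have EP l : E (lit_formula l) <-> concluded T l.
  by apply: closure_lits; apply: coherent_concluded.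
have app d i : (forall f, stage D W E i f -> E f) ->
    prerequisite_in d (stage D W E i) -> applicable T d.
  move=> hE; rewrite /prerequisite_in /prerequisite => hp p e.
  move: hp; rewrite e => /hE.
  by rewrite -[FVar p]/(lit_formula (true, p)) => /EP.
have sub : forall i f, stage D W E i f -> E f.
  elim=> [|i IH] f /=.
    case=> l Wl ->; apply/EP; case: l Wl => [[] a] Wl; rewrite /concluded /=.
      exact: positive_fact Wl.
    by split; [apply: positive_negated Wl|left].
  case=> [|[d Dd [hp nE ->]]].
    by apply: closure_le => g /IH.
  have aT := app d i IH hp; apply/EP; rewrite /concluded.
  case e : (consequent d) nE => [[] y] nE /=.
    have e' : d.2 = (true, y) by [].
    have := positive_closed vT Dd _ aT; rewrite e' /= => /(_ isT)[//|neg].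
    apply: boolp.contrapT => nTy; apply: nE; apply/EP.
    by split.
  split; first by move=> Ty; apply: nE; apply/EP.
  by right; exists d.
have up l : concluded T l -> exists i, stage D W E i (lit_formula l).
  have pos a : derivable T a -> exists i, stage D W E i (FVar a).
    elim=> {a} [a Wa _|d a Dd e Ta _ IH].
      by exists 0; exists (true, a).
    have [i hi] : exists i, prerequisite_in d (stage D W E i).
      rewrite /prerequisite_in /prerequisite; case: d.1 IH => [p|] IH.
        exact: IH.
      by exists 0.
    exists i.+1; right; exists d => //; rewrite /consequent e; split=> //.
    by move/EP => -[].
  case: l => [[] a]; rewrite /concluded /=.
    by move=> /(positive_derivable vT)/pos.
  case=> nTa [Wa|[d [Dd e aT]]]; first by exists 0; exists (false, a).
  have [i hi] : exists i, prerequisite_in d (stage D W E i).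
    rewrite /prerequisite_in /prerequisite.
    case e1: d.1 => [p|]; last by exists 0.
    by apply: pos; apply: positive_derivable => //; apply: aT.
  exists i.+1; right; exists d => //; rewrite /consequent e; split=> //.
  by move/EP.
(* The closure is taken at a single stage, so one stage must contain all concluded literals. They
   occur in W or as consequents, hence are finitely many, and a maximum of stages exists. *)
have [i hi] : exists i, forall l, l \in W ++ map snd D -> concluded T l ->
    stage D W E i (lit_formula l).
  elim: (W ++ _) => [|l s [i hi]]; first by exists 0.
  have [cl|ncl] := boolp.pselect (concluded T l); last first.
    by exists i => k; rewrite inE => /predU1P[-> //|]; apply: hi.
  have [j hj] := up l cl; exists (maxn i j) => k.
  rewrite inE => /predU1P[-> _|ks ck].
    by apply: stage_mono hj; apply: leq_maxr.
  by apply: stage_mono (hi k ks ck); apply: leq_maxl.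
apply/seteqP; split=> [f Ef|f [j /sub]//].
exists i.+1; left; move: f Ef; apply: closure_le => _ [l cl ->].
apply: closure_sub; apply: hi => //; rewrite mem_cat.
case: l cl => [[] a]; rewrite /concluded /=.
  move=> /(positive_derivable vT)[{}a -> //|d {}a Dd e _ _].
  by apply/orP; right; apply/mapP; exists d.
case=> _ [-> //|[d [Dd e _]]].
by apply/orP; right; apply/mapP; exists d.
Qed.

(** Every stage lies in the closure of [X']: facts and consequents of applicable unblocked defaults,
    the positive ones being derivable. As [X'] is coherent, taking closures adds no further literal,
    so the literals of E are those of [X']. *)
Lemma extension_positive_part E :
  coherent (fun l => l \in W) -> is_extension D W E ->
  exists2 T, positive_part T &
    forall l, E (lit_formula l) <-> concluded T l.
Proof.
move=> cW extE; pose T a := E (FVar a).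
have EP f : E f <-> exists i, stage D W E i f by rewrite {1}extE.
pose X l := l \in W \/
  exists d, [/\ d \in D, d.2 = l, applicable T d
             & ~ E (lit_formula (lit_neg l))].
have EW l : l \in W -> E (lit_formula l).
  by move=> Wl; apply/EP; exists 0; exists l.
have XE l : X l -> E (lit_formula l).
  case=> [/EW//|[d [Dd e aT nE]]]; apply/EP.
  have [i hi] : exists i, prerequisite_in d (stage D W E i).
    rewrite /prerequisite_in /prerequisite.
    case e1: d.1 => [p|]; last by exists 0.
    by apply/EP; apply: aT.
  by exists i.+1; right; exists d; rewrite // /consequent e.
(* An unblocked default requires the opposite literal to be absent from E, which contains X; two
   opposite facts are excluded by coherence of W. *)
have cX : coherent X.
  move=> a X1 X2; have E1 := XE _ X1; have E2 := XE _ X2.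
  case: X1 => [W1|[d [_ _ _]]]; last exact.
  case: X2 => [W2|[d [_ _ _]]]; last exact.
  exact: cW W1 W2.
pose X' l := X l /\ (l.1 -> derivable T l.2).
have cX' : coherent X' by move=> a [X1 _] [X2 _]; apply: cX X1 X2.
have sub : forall i f, stage D W E i f -> logical_closure (lits X') f.
  elim=> [|i IH] f /=.
    case=> l Wl ->; apply/closure_lits => //; split; first by left.
    case: l Wl => [[] a] //= Wa _; apply: derivable_fact => //.
    exact: (EW _ Wa).
  case; first by apply: closure_le.
  case=> d Dd [hp nE ->]; apply/closure_lits => //.
  have Xd : X (consequent d).
    right; exists d; split=> // p e; apply/EP; exists i.
    by move: hp; rewrite /prerequisite_in /prerequisite e.
  split=> //; case e: (consequent d) Xd => [[] a] //= Xd _.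
  apply: (derivable_default Dd e); first exact: (XE _ Xd).
  move=> p ep; move: hp; rewrite /prerequisite_in /prerequisite ep.
  rewrite -[FVar p]/(lit_formula (true, p)) => /IH/closure_lits[//|_].
  exact.
have EX l : E (lit_formula l) -> X' l.
  by move=> /EP[i /sub/closure_lits]; apply.
have neg a : X (false, a) -> negatable T a.
  by case=> [|[d [Dd e aT _]]]; [left|right; exists d].
have nT a : E (lit_formula (false, a)) -> ~ T a.
  move=> /EX[X1 _] Ta; have [X2 _] := EX (true, a) Ta.
  exact: cX X2 X1.
exists T.
  split.
  - by move=> a /EW.
  - by move=> a /EW/nT.
  - by move=> a /(EX (true, a))[_]; apply.
  - move=> d Dd; case e: d.2 => [[] y] //= _ aT.
    have [Ey|nEy] := boolp.pselect (E (lit_formula (false, y))).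
      by right; apply: neg; apply: (EX _ Ey).1.
    by left; apply: (XE (true, y)); right; exists d.
case=> [[] a]; rewrite /concluded /=; first by [].
split=> [Ea|[nTa [Wa|[d [Dd e aT]]]]]; first split.
- exact: nT.
- by apply: neg; apply: (EX _ Ea).1.
- exact: (EW _ Wa).
- by apply: (XE (false, a)); right; exists d.
Qed.

Lemma entails_lit l : coherent (fun l => l \in W) ->
  entails D W (lit_formula l) <->
  forall T, positive_part T -> concluded T l.
Proof.
move=> cW; split=> [h T vT|h E /(extension_positive_part cW)[T vT ->]].
  have := h _ (extension_concluded vT).
  by move/closure_lits; apply; apply: coherent_concluded.
exact: h.
Qed.

End Facts.

(** B is closed under ancestors. The new set consists of the letters derivable inside K, which
    copies T on B and elsewhere allows every letter not negated by W'. Outside B, positive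
    consequents thus win over negative defaults: a letter to which an applicable default leads is
    either derived or negated by W' itself. *)
Lemma positive_part_restrict (B : letter -> Prop) W W' T :
  (forall d p, d \in D -> B d.2.2 -> d.1 = Some p -> B p) ->
  (forall l, B l.2 -> (l \in W) = (l \in W')) ->
  coherent (fun l => l \in W') -> positive_part W T ->
  exists2 T', positive_part W' T' &
    forall l, B l.2 -> concluded W' T' l <-> concluded W T l.
Proof.
move=> clB eqW cW' vT.
pose K a := (B a -> T a) /\ (~ B a -> (false, a) \notin W').
have KT a : derivable W' K a -> K a by case.
have TK a : derivable W T a -> B a -> derivable W' K a.
  have TKa x : T x -> B x -> K x by split.
  elim=> {a} [a Wa Ta Ba|d a Dd e Ta _ IH Ba].
    by apply: derivable_fact; [rewrite -eqW|apply: TKa].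
  apply: (derivable_default Dd e); first exact: TKa.
  by move=> p ep; apply: IH => //; apply: clB Dd _ ep; rewrite e.
have TP a : B a -> derivable W' K a <-> T a.
  move=> Ba; split; first by move=> /KT[/(_ Ba)].
  by move=> /(positive_derivable vT)/TK; apply.
have appP d : d \in D -> B d.2.2 ->
    applicable (derivable W' K) d <-> applicable T d.
  by move=> Dd Bd; split=> h p e; have := h p e; rewrite TP //; apply: clB e.
have negatP a : B a -> negatable W' (derivable W' K) a <-> negatable W T a.
  move=> Ba; split=> -[Wa|[d [Dd e]]].
  - by left; rewrite eqW.
  - by rewrite appP ?e // => ad; right; exists d.
  - by left; rewrite -eqW.
  - by rewrite -appP ?e // => ad; right; exists d.
exists (derivable W' K).
  split.
  - move=> a Wa; apply: derivable_fact => //; split=> [Ba|_].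
      by apply: positive_fact vT _ _; rewrite eqW.
    by apply/negP => /(cW' a Wa).
  - move=> a Wa /KT[h1 h2]; have [Ba|nBa] := boolp.pselect (B a).
      by apply: (positive_negated vT _ (h1 Ba)); rewrite eqW.
    by have := h2 nBa; rewrite Wa.
  - move=> a; elim=> {a} [a Wa Ka|d a Dd e Ka h IH].
      by apply: derivable_fact => //; apply: derivable_fact.
    apply: (derivable_default Dd e) => //.
    exact: (derivable_default Dd e).
  - move=> d Dd e ad; have [Bd|nBd] := boolp.pselect (B d.2.2).
      have aT : applicable T d by apply/appP.
      case: (positive_closed vT Dd e aT) => h; first by left; apply/TP.
      by right; apply/negatP.
    have [Wd|nWd] := boolP ((false, d.2.2) \in W'); first by right; left.
    left; apply: (derivable_default Dd) => //; first by case: d.2 e => [[]]. 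
move=> l Bl; rewrite /concluded; case: l.1; first exact: TP.
by rewrite negatP // TP.
Qed.

Lemma entails_restrict (B : letter -> Prop) W W' l :
  (forall d p, d \in D -> B d.2.2 -> d.1 = Some p -> B p) ->
  (forall l, B l.2 -> (l \in W) = (l \in W')) ->
  coherent (fun l => l \in W) -> coherent (fun l => l \in W') -> B l.2 ->
  entails D W (lit_formula l) -> entails D W' (lit_formula l).
Proof.
move=> clB eqW cW cW' Bl /(entails_lit _ cW) h.
apply/(entails_lit _ cW') => T vT.
have eqW' k : B k.2 -> (k \in W') = (k \in W) by move=> /eqW ->.
have [T' vT' eqT] := positive_part_restrict clB eqW' cW vT.
by apply/eqT => //; apply: h.
Qed.

End Extensions.

(** * Deciding the entailment of a literal *)

(** Every round before stabilization removes an element, so [size V] rounds suffice to reach a fixed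
    point. *)
Definition shrink (Q : seq letter -> letter -> bool) (V : seq letter) :
  seq letter := iter (size V) (fun R => filter (Q R) R) V.

Lemma shrink_stable Q V a : a \in shrink Q V -> Q (shrink Q V) a.
Proof.
pose f R := filter (Q R) R.
have stable n U : size U <= n -> f (iter n f U) = iter n f U.
  elim: n U => [|n IH] U; first by rewrite leqn0 => /nilP ->.
  move=> le_n; rewrite iterSr.
  have [lt_s|le_s] := ltnP (size (f U)) (size U).
    by apply: IH; rewrite -ltnS; apply: leq_trans lt_s le_n.
  have fU : f U = U.
    apply/all_filterP; rewrite all_count eqn_leq count_size.
    by move: le_s; rewrite size_filter.
  by rewrite fU iter_fix.
have {stable} := stable _ V (leqnn _); rewrite -/(shrink Q V) => e.
by rewrite -{1}e mem_filter => /andP[].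
Qed.

Lemma shrink_sub Q V : {subset shrink Q V <= V}.
Proof.
rewrite /shrink; elim: (size V) => //= n IH a.
by rewrite mem_filter => /andP[_ /IH].
Qed.

Lemma shrink_max (Q : seq letter -> letter -> bool) (V : seq letter)
    (X : letter -> Prop) :
  (forall a, X a -> a \in V) ->
  (forall R : seq letter,
     (forall a, X a -> a \in R) -> forall a, X a -> Q R a) ->
  forall a, X a -> a \in shrink Q V.
Proof.
move=> XV XQ; rewrite /shrink; elim: (size V) => //= n IH a Xa.
by rewrite mem_filter IH // andbT; apply: XQ.
Qed.

Section Algorithm.
Variables (D : seq default) (W : seq literal).

Definition negatableb (T : seq letter) (y : letter) : bool :=
  ((false, y) \in W) ||
  has (fun d => (d.2 == (false, y)) &&
                all (fun p => p \in T) (seq_of_opt d.1)) D.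

(** The complement in T of a least fixed point, written as a greatest one so that [shrink] applies.
    On an empty prerequisite [has] is false, so a letter concluded by a default without prerequisite
    is discarded. *)
Definition underivable (T : seq letter) : seq letter :=
  shrink (fun U a => ((true, a) \notin W) &&
    all (fun d => (d.2 == (true, a)) ==>
           has (fun p => (p \in U) || (p \notin T)) (seq_of_opt d.1)) D) T.

(** F lists the letters to avoid. A default is checked at its prerequisite a, so a violation is
    cured by discarding a. *)
Definition greatest (F : seq letter) : seq letter :=
  shrink (fun T a => (a \notin underivable T) &&
    all (fun d => ((d.1 == Some a) && d.2.1) ==>
           ((d.2.2 \in T) || negatableb T d.2.2)) D)
  (filter (fun a => (a \notin F) && ((false, a) \notin W))
    (theory_letters D W)).

(** These conditions are monotone in T: if they fail for the greatest candidate, they fail for every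
    smaller one. *)
Definition closed_at_root (T : seq letter) : bool :=
  all (fun l => l.1 ==> (l.2 \in T)) W &&
  all (fun d => ((d.1 == None) && d.2.1) ==>
         ((d.2.2 \in T) || negatableb T d.2.2)) D.

(** An extension lacks ~x either because x is in T or because nothing concludes ~x; the latter means
    that T avoids the prerequisites of all defaults for ~x. It lacks x when T avoids x. *)
Definition avoidable (l : literal) : bool :=
  if l.1 then
    (closed_at_root (greatest [::]) && (l.2 \in greatest [::])) ||
    [&& (false, l.2) \notin W,
        all (fun d => (d.2 == (false, l.2)) ==> (d.1 != None)) D
      & closed_at_root (greatest
          (filter (fun a => (Some a, (false, l.2)) \in D)
            (theory_letters D W)))]
  else closed_at_root (greatest [:: l.2]).

Lemma applicableP (T : seq letter) d :
  reflect (applicable (fun a => a \in T) d)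
    (all (fun p => p \in T) (seq_of_opt d.1)).
Proof.
apply: (iffP allP) => h p; first by move=> e; apply: h; rewrite e inE.
by case e: d.1 => [q|] //; rewrite inE => /eqP->; apply: h.
Qed.

Lemma negatableP (T : seq letter) y :
  reflect (negatable D W (fun a => a \in T) y) (negatableb T y).
Proof.
apply: (iffP orP) => -[Wy|]; [by left| |by left|]; last first.
  case=> d [Dd e /applicableP ad]; right; apply/hasP; exists d => //.
  by rewrite e eqxx ad.
by case/hasP => d Dd /andP[/eqP e /applicableP ad]; right; exists d.
Qed.

Lemma underivableP (T : seq letter) a : a \in T ->
  (a \notin underivable T) <-> derivable D W (fun a => a \in T) a.
Proof.
move=> Ta; split=> [/negP nU|].
  apply: boolp.contrapT => nd; apply: nU.
  move: (conj Ta nd); clear Ta nd; move: a.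
  apply: shrink_max => [a []//|].
  move=> R XR a [Ta nd]; apply/andP; split.
    by apply/negP => Wa; apply: nd; apply: derivable_fact.
  apply/allP => d Dd; apply/implyP => /eqP e.
  apply: boolp.contrapT; move/negP; rewrite -all_predC => /allP h; apply: nd.
  apply: (derivable_default Dd e) => // p ep.
  have := h p; rewrite ep inE eqxx => /(_ isT) /=.
  rewrite negb_or negbK => /andP[pR pT].
  by apply: boolp.contrapT => npd; move/negP: pR; apply; apply: XR.
elim=> {a Ta} [a Wa _|d a Dd e Ta hd IH].
  by apply/negP => /shrink_stable; rewrite Wa.
apply/negP => /shrink_stable/andP[_ /allP/(_ d Dd)].
rewrite e eqxx /= => /hasP[p]; case ep : d.1 => [q|] //; rewrite inE => /eqP->.
have Tq : q \in T by case: (hd q ep).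
by rewrite Tq orbF (negbTE (IH q ep)).
Qed.

Lemma derivable_le (T T' : letter -> Prop) a :
  (forall a, T a -> T' a) -> derivable D W T a -> derivable D W T' a.
Proof.
move=> TT'; elim=> {a} [a Wa Ta|d a Dd e Ta _ IH].
  by apply: derivable_fact => //; apply: TT'.
by apply: (derivable_default Dd e) => //; apply: TT'.
Qed.

Lemma negatable_le (T T' : letter -> Prop) y :
  (forall a, T a -> T' a) -> negatable D W T y -> negatable D W T' y.
Proof.
move=> TT' [|[d [Dd e ad]]]; [by left|right; exists d; split=> // p ep].
by apply: TT'; apply: ad.
Qed.

Lemma derivable_letter T a : derivable D W T a -> a \in theory_letters D W.
Proof.
rewrite mem_cat; case=> {a} [a Wa _|d a Dd e _ _]; apply/orP.
  by right; apply/mapP; exists (true, a).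
left; apply/flattenP; exists (default_letters d); first by apply: map_f.
by rewrite mem_rcons inE /consequent e eqxx.
Qed.

Lemma positive_part_greatest F :
  coherent (fun l => l \in W) -> closed_at_root (greatest F) ->
  positive_part D W (fun a => a \in greatest F).
Proof.
move=> cW /andP[/allP okW /allP okD]; split.
- by move=> a /okW.
- by move=> a Wa /shrink_sub; rewrite mem_filter Wa andbF.
- move=> a Ga; apply/underivableP => //.
  by have /andP[] := shrink_stable Ga.
- move=> d Dd e ad.
  suff /orP[|/negatableP] :
    (d.2.2 \in greatest F) || negatableb (greatest F) d.2.2 by [left|right].
  case ep : d.1 => [p|]; last by have := okD d Dd; rewrite ep e.
  have /shrink_stable/andP[_ /allP/(_ d Dd)] := ad p ep.
  by rewrite ep eqxx e.
Qed.

Lemma greatest_max F T :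
  positive_part D W T -> (forall a, a \in F -> ~ T a) ->
  closed_at_root (greatest F) /\ forall a, T a -> a \in greatest F.
Proof.
move=> vT TF.
have TG a : T a -> a \in greatest F.
  move: a; apply: shrink_max => [a Ta|R TR a Ta].
    rewrite mem_filter (derivable_letter (positive_derivable vT Ta)) andbT.
    apply/andP; split; apply/negP; first by move=> /TF.
    by move=> /(positive_negated vT).
  apply/andP; split.
    apply/underivableP; first exact: TR.
    exact: derivable_le (positive_derivable vT Ta).
  apply/allP => d Dd; apply/implyP => /andP[/eqP ep e].
  have [|Tb|nb] := positive_closed vT Dd e.
  - by move=> p; rewrite ep => -[<-].
  - by rewrite TR.
  - by apply/orP; right; apply/negatableP; apply: negatable_le nb.
split=> //; apply/andP; split.
  by apply/allP => -[[] a] //= /(positive_fact vT)/TG.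
apply/allP => d Dd; apply/implyP => /andP[/eqP ep e].
have [|Tb|nb] := positive_closed vT Dd e.
- by move=> p; rewrite ep.
- by rewrite TG.
- by apply/orP; right; apply/negatableP; apply: negatable_le nb.
Qed.

Lemma avoidableP l : coherent (fun l => l \in W) ->
  avoidable l <-> ~ entails D W (lit_formula (lit_neg l)).
Proof.
move=> cW.
have -> : (~ entails D W (lit_formula (lit_neg l))) <->
    exists2 T, positive_part D W T & ~ concluded D W T (lit_neg l).
  rewrite entails_lit //; split=> [h|[T vT nT] /(_ T vT)//].
  apply: boolp.contrapT => h'; apply: h => T vT; apply: boolp.contrapT => nT.
  by apply: h'; exists T.
case: l => [[] x]; rewrite /avoidable /concluded /=; last first.
  split=> [/positive_part_greatest vT|[T vT nT]].
    exists (fun a => a \in greatest [:: x]); first exact: vT.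
    by move=> /shrink_sub; rewrite mem_filter inE eqxx.
  by apply: (greatest_max vT _).1 => a; rewrite inE => /eqP->.
set F := filter _ _.
have FP a : (a \in F) = ((Some a, (false, x)) \in D).
  rewrite mem_filter; case h : (_ \in D) => //=.
  rewrite mem_cat; apply/orP; left; apply/flattenP.
  exists (default_letters (Some a, (false, x))); first by apply: map_f.
  by rewrite inE eqxx.
split=> [/orP[/andP[c Gx]|/and3P[nW /allP root c]]|[T vT nT]].
- exists (fun a => a \in greatest [::]); first exact: positive_part_greatest.
  by case=> /(_ Gx).
- exists (fun a => a \in greatest F); first exact: positive_part_greatest.
  case=> _ [|[d [Dd e ad]]]; first by rewrite (negbTE nW).
  have := root d Dd; rewrite e eqxx; case ep : d.1 => [p|] // _.
  have /shrink_sub := ad p ep; rewrite mem_filter FP -ep -e -surjective_pairing.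
  by rewrite Dd.
- apply/orP; have [Tx|nTx] := boolp.pselect (T x); [left|right].
    have [//|c TG] := @greatest_max [::] T vT.
    by rewrite c TG.
  have {}nT : ~ negatable D W T x by move=> h; apply: nT.
  apply/and3P; split.
  + by apply/negP => h; apply: nT; left.
  + apply/allP => d Dd; apply/implyP => /eqP e; apply/eqP => ep.
    by apply: nT; right; exists d; split=> // p; rewrite ep.
  + apply: (greatest_max vT _).1 => a; rewrite FP => Da Ta.
    by apply: nT; right; exists (Some a, (false, x)); split=> // p [<-].
Qed.

End Algorithm.

(** * Strong outliers in quasi-acyclic theories *)

(** The letters not reachable from x form the largest set that omits x and contains all predecessors
    of its members. *)
Definition unreachable (D : seq default) (W : seq literal) (x : letter) :
  seq letter :=
  shrink (fun U a => (a != x) &&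
      all (fun d => (d.2.2 == a) ==> all (fun p => p \in U) (seq_of_opt d.1)) D)
    (theory_letters D W).

(** As c is fixed, comparing the size of a component with c amounts to dropping c elements and
    testing emptiness, without arithmetic. *)
Definition tight (c : nat) (D : seq default) (W : seq literal) : bool :=
  all (fun x => nilp (drop c
      (filter (fun y => (y \notin unreachable D W x) &&
                        (x \notin unreachable D W y))
        (undup (theory_letters D W)))))
    (theory_letters D W).

Definition consistentb (W : seq literal) : bool :=
  all (fun l => (~~ l.1, l.2) \notin W) W.

Definition witnessb (D : seq default) (W L S : seq literal) : bool :=
  all (fun l => ~~ avoidable D (lits_minus W S) l) S &&
  all (fun l => avoidable D (lits_minus W (S ++ L)) l) S.

(** Repetitions are allowed, so sequences of length exactly k cover all non-empty sets of at most k
    elements. For fixed k this is k nested loops. *)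
Fixpoint search (k : nat) (P : seq literal -> bool) (V acc : seq literal) :
  bool :=
  if k is j.+1 then has (fun l => search j P V (l :: acc)) V else P acc.

Definition outlierb (c : nat) (D : seq default) (W L : seq literal) : bool :=
  all (fun l => l \in W) L && search c (witnessb D W L) (lits_minus W L) [::].

Lemma consistentbP W : reflect (coherent (fun l => l \in W)) (consistentb W).
Proof.
apply: (iffP allP) => [h a /h/negP//|cW [[] a] Wa] /=; apply/negP => Wb.
  exact: cW Wa Wb.
exact: cW Wb Wa.
Qed.

Lemma searchP k P V acc :
  search k P V acc <->
  exists s, [/\ size s = k, {subset s <= V} & P (s ++ acc)].
Proof.
elim: k acc => [|k IH] acc /=.
  by split=> [Pa|[s [/size0nil-> _]]//]; exists [::].
split=> [/hasP[l Vl /IH[s [sk sV Ps]]]|[s [sk sV Ps]]].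
  exists (rcons s l); rewrite size_rcons sk cat_rcons; split=> // x.
  by rewrite mem_rcons inE => /predU1P[->|/sV].
case/lastP: s sk sV Ps => // s l; rewrite size_rcons cat_rcons => -[sk] sV Ps.
apply/hasP; exists l; first by apply: sV; rewrite mem_rcons mem_head.
apply/IH; exists s; split=> // x sx.
by apply: sV; rewrite mem_rcons inE sx orbT.
Qed.

Lemma exists_minimal (T : eqType) (r : rel T) (s : seq T) :
  transitive r -> s != [::] ->
  exists2 x, x \in s & forall y, y \in s -> r y x -> r x y.
Proof.
move=> tr; elim: s => // a s IH _; have [->|/IH[x sx hx]] := eqVneq s [::].
  by exists a; rewrite ?mem_head // => y; rewrite inE => /eqP->.
(* The new element a replaces the minimal x only when it lies strictly below x. *)
have [/andP[rax nrxa]|h] := boolP (r a x && ~~ r x a).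
  exists a; rewrite ?mem_head // => y; rewrite inE => /predU1P[->//|sy] rya.
  by apply: (tr _ _ _ rax); apply: hx => //; apply: (tr _ _ _ rya rax).
exists x; first by rewrite inE sx orbT.
move=> y; rewrite inE => /predU1P[->|/hx//] rax.
by move: h; rewrite rax negbK.
Qed.

(** * Dependency graph, components and small witness sets *)

Section Graph.
Variables (D : seq default) (W : seq literal).
Let e := @dep_edge D W.

Lemma theory_letter_default d p : d \in D ->
  (d.1 == Some p) || (d.2.2 == p) -> p \in theory_letters D W.
Proof.
move=> Dd h; rewrite mem_cat; apply/orP; left; apply/flattenP.
exists (default_letters d); first exact: map_f.
rewrite mem_rcons inE /consequent /prerequisite.
by case/orP: h => /eqP->; rewrite ?eqxx // inE eqxx orbT.
Qed.

Lemma unreachableP (x y : dep_vertex D W) :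
  (val y \notin unreachable D W (val x)) = connect e x y.
Proof.
apply/idP/idP => [|/connectP[p pp ->]].
  apply: contraR => nc.
  apply: (@shrink_max _ _ (fun a =>
    exists2 z : dep_vertex D W, val z = a & ~~ connect e x z)).
  - by move=> _ [z <- _]; apply: valP.
  - move=> R XR _ [z <- nxz]; apply/andP; split.
      by apply: contraNneq nxz => /val_inj ->; apply: connect0.
    apply/allP => d Dd; apply/implyP => /eqP ez; apply/allP => q.
    case ep : d.1 => [p|] //; rewrite inE => /eqP->.
    have Vp : p \in theory_letters D W.
      by apply: (theory_letter_default Dd); rewrite ep eqxx.
    apply: XR; exists (SeqSub Vp) => //; apply: contra nxz => cp.
    apply: connect_trans cp (connect1 _); apply/hasP; exists d => //=.
    by rewrite /prerequisite /consequent ep ez !eqxx.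
  - by exists y.
elim/last_ind: p pp => [_|p z IH].
  by apply/negP => /shrink_stable; rewrite eqxx.
rewrite rcons_path last_rcons => /andP[pp].
move=> /hasP[d Dd /andP[/eqP ep /eqP ez]]; apply/negP.
move=> /shrink_stable/andP[_ /allP/(_ d Dd)].
rewrite -/(consequent d) ez eqxx -/(prerequisite d) ep /= andbT.
exact/negP/IH.
Qed.

Lemma tightP c : tight c D W = (tightness D W <= c).
Proof.
have sccE (x : dep_vertex D W) : #|scc e x| =
    size (filter (fun y => (y \notin unreachable D W (val x)) &&
                           (val x \notin unreachable D W y))
           (undup (theory_letters D W))).
  rewrite cardE -(size_map val); apply/perm_size/uniq_perm.
  - by rewrite map_inj_uniq ?enum_uniq //; apply: val_inj.
  - by rewrite filter_uniq ?undup_uniq.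
  - move=> a; rewrite mem_filter mem_undup; apply/mapP/andP.
      case=> y; rewrite mem_enum inE -!unreachableP => h ->; split=> //.
      exact: valP.
    case=> h Va; exists (SeqSub Va) => //.
    by rewrite mem_enum inE -!unreachableP.
apply/allP/bigmax_leqP => [h x _|h x Vx].
  by have := h _ (valP x); rewrite /nilp size_drop subn_eq0 -sccE.
by rewrite /nilp size_drop subn_eq0 -(sccE (SeqSub Vx)) h.
Qed.

Definition reach (x y : letter) : bool :=
  [exists u : dep_vertex D W, exists v : dep_vertex D W,
    [&& val u == x, val v == y & connect e u v]].

Lemma reachP x y :
  reflect
    (exists u v : dep_vertex D W, [/\ val u = x, val v = y & connect e u v])
    (reach x y).
Proof.
apply: (iffP existsP) => -[u].
  by case/existsP=> v /and3P[/eqP ux /eqP vy c]; exists u, v.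
by case=> v [ux vy c]; exists u; apply/existsP; exists v; rewrite ux vy !eqxx.
Qed.

Lemma reach_trans : transitive reach.
Proof.
move=> y x z /reachP[u [v [ux vy uv]]] /reachP[v' [w [v'y wz vw]]].
apply/reachP; exists u, w; split=> //; apply: connect_trans uv _.
by have -> : v = v' by apply: val_inj; rewrite /= vy v'y.
Qed.

Lemma witness_eq L S S' : S =i S' ->
  strong_outlier_witness D W L S -> strong_outlier_witness D W L S'.
Proof.
move=> eS [S0 SW h1 h2].
have e1 X : lits_minus X S' = lits_minus X S.
  by apply: eq_filter => l; rewrite eS.
have e2 X : lits_minus X (S' ++ L) = lits_minus X (S ++ L).
  by apply: eq_filter => l; rewrite !mem_cat eS.
split.
- case: S' eS {e1 e2} => // eS; case: S S0 eS {SW h1 h2} => // l S _ /(_ l).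
  by rewrite mem_head.
- by move=> l; rewrite -eS; apply: SW.
- by move=> l; rewrite -eS e1; apply: h1.
- by move=> l; rewrite -eS e2; apply: h2.
Qed.

(* The entailments of condition (1) and (2) for a letter depend only on its
   ancestors, so a component of S that is minimal in the dependency order is
   already a witness set. *)
Lemma small_witness c L S :
  coherent (fun l => l \in W) -> 0 < c -> tightness D W <= c ->
  strong_outlier_witness D W L S ->
  exists2 S', size S' = c & strong_outlier_witness D W L S'.
Proof.
move=> cW c0 tc [S0 SW h1 h2].
have [l0 Sl0 minl0] : exists2 l, l \in S &
    forall k, k \in S -> reach k.2 l.2 -> reach l.2 k.2.
  apply: (@exists_minimal _ (fun k l : literal => reach k.2 l.2)) S0.
  by move=> k l m; apply: reach_trans.
have Wl l : l \in S -> l \in W by move=> /SW; rewrite mem_filter => /andP[].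
have Vl l : l \in S -> l.2 \in theory_letters D W.
  by move=> /Wl Wl'; rewrite mem_cat map_f ?orbT.
pose x0 : dep_vertex D W := SeqSub (Vl _ Sl0).
(* S1 collects the members of S whose letters are ancestors of that of l0; by minimality they lie in
   its component. Removing S or S1 from W makes no difference on ancestors of l0, which is what
   [entails_restrict] asks for. *)
pose S1 := filter (fun l => reach l.2 l0.2) S.
have S1l0 : l0 \in S1.
  by rewrite mem_filter Sl0 andbT; apply/reachP; exists x0, x0.
have clB d p : d \in D -> reach d.2.2 l0.2 -> d.1 = Some p -> reach p l0.2.
  move=> Dd /reachP[u [v [ud vl uv]]] ep.
  have Vp : p \in theory_letters D W.
    by apply: (theory_letter_default Dd); rewrite ep eqxx.
  apply/reachP; exists (SeqSub Vp), v; split=> //.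
  apply: connect_trans (connect1 _) uv; apply/hasP; exists d => //=.
  by rewrite /prerequisite /consequent ep ud !eqxx.
have cM X : coherent (fun l => l \in lits_minus W X).
  by move=> a; rewrite !mem_filter => /andP[_ Wa] /andP[_]; apply: cW.
have eqM X (k : literal) : reach k.2 l0.2 ->
    (k \in lits_minus W (S ++ X)) = (k \in lits_minus W (S1 ++ X)).
  by move=> rk; rewrite !mem_filter !mem_cat mem_filter rk.
have wS1 : strong_outlier_witness D W L S1.
  split.
  - by case: (S1) S1l0.
  - by move=> l; rewrite mem_filter => /andP[_ /SW].
  - move=> l; rewrite mem_filter => /andP[rl Sl].
    have := h1 l Sl; apply: (entails_restrict clB) => // k rk.
    by have := eqM [::] k rk; rewrite !cats0.
  - move=> l; rewrite mem_filter => /andP[rl Sl] h; apply: (h2 l Sl).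
    by move: h; apply: (entails_restrict clB) => // k rk; rewrite eqM.
(* Coherence of W makes the letters of distinct literals of S1 distinct, so S1 embeds into the
   component of l0. *)
have sS1 : size (undup S1) <= c.
  apply: leq_trans (leq_trans (leq_bigmax x0) tc).
  rewrite cardE -(size_map val) -(size_map snd); apply: uniq_leq_size.
    rewrite map_inj_in_uniq ?undup_uniq // => k l.
    rewrite !mem_undup !mem_filter => /andP[_ /Wl Wk] /andP[_ /Wl Wl'].
    case: k l Wk Wl' => [b a] [b' a'] Wk Wl' /= eaa; subst a'.
    case: b b' Wk Wl' => [] [] // Wk Wl'; first by case: (cW a Wk Wl').
    by case: (cW a Wl' Wk).
  move=> a /mapP[l]; rewrite mem_undup mem_filter => /andP[rl Sl] ->.
  apply/mapP; exists (SeqSub (Vl _ Sl)) => //.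
  rewrite mem_enum inE.
  have /reachP[u [v [ul vl uv]]] := rl.
  have /reachP[v' [u' [v'l u'l uv']]] := minl0 l Sl rl.
  have -> : SeqSub (Vl _ Sl) = u by apply: val_inj; rewrite /= ul.
  have -> : x0 = v by apply: val_inj; rewrite /= vl.
  rewrite uv andbT.
  have <- : v' = v by apply: val_inj; rewrite /= vl v'l.
  by have <- : u' = u by apply: val_inj; rewrite /= ul u'l.
(* Padding with copies of l0 gives the exact length that [search] enumerates. *)
exists (undup S1 ++ nseq (c - size (undup S1)) l0).
  by rewrite size_cat size_nseq subnKC.
apply: witness_eq wS1 => l; rewrite mem_cat mem_undup mem_nseq.
by case: eqP => [->|_]; rewrite ?S1l0 // andbF orbF.
Qed.

End Graph.

Lemma witnessP D W L S : coherent (fun l => l \in W) -> S != [::] ->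
  {subset S <= lits_minus W L} ->
  witnessb D W L S <-> strong_outlier_witness D W L S.
Proof.
move=> cW S0 SW.
have cM X : coherent (fun l => l \in lits_minus W X).
  by move=> a; rewrite !mem_filter => /andP[_ Wa] /andP[_]; apply: cW.
split=> [/andP[/allP h1 /allP h2]|[_ _ h1 h2]].
  split=> // l Sl; last by apply/avoidableP => //; apply: h2.
  apply: boolp.contrapT => h; have /negP := h1 l Sl; apply.
  by apply/avoidableP.
apply/andP; split; apply/allP => l Sl.
  by apply/negP => /avoidableP; apply=> //; apply: h1.
by apply/avoidableP => //; apply: h2.
Qed.

Lemma outlierP c D W L :
  coherent (fun l => l \in W) -> 0 < c -> tightness D W <= c ->
  outlierb c D W L <-> strong_outlier_set D W L.
Proof.
move=> cW c0 tc; split=> [/andP[/allP LW /searchP[S [Sc SV]]]|[LW [S wS]]].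
  rewrite cats0 => /witnessP wS; split=> //; exists S; apply: wS => //.
  by case: S Sc {SV}; case: c c0 {tc}.
have [S' Sc wS'] := small_witness cW c0 tc wS.
apply/andP; split; first exact/allP.
apply/searchP; exists S'; case: (wS') => S0 SW _ _; split=> //.
by rewrite cats0; apply/witnessP.
Qed.

(** * Polynomial time of the decision procedure *)

(** A hook, redefined as the functions of the decision procedure are shown to be polynomial. *)
Ltac polytime_call := fail.

Ltac polytime_step :=
  cbv beta;
  match goal with
  | |- polytime_over _ _ => assumption
  | |- polytime_eq_over _ _ =>
      first [ exact: polytime_eq_bool | apply: polytime_eq_pair
            | apply: polytime_eq_seq | apply: polytime_eq_option
            | exact: polytime_eq_base ]
  | |- polytime_over _ (fun x => x) => exact: polytime_id
  | |- polytime_over _ fst => exact: polytime_fst0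
  | |- polytime_over _ snd => exact: polytime_snd0
  | |- polytime_over _ (fun _ => ?c) => exact: polytime_const
  | H : polytime_over _ ?f |- polytime_over _ (fun x => ?f (@?g x)) =>
      apply: (polytime_comp (f := g) H)
  | |- polytime_over _ (fun x => (@?f x, @?g x)) =>
      apply: (polytime_pair (f := f) (g := g))
  | |- polytime_over _ (fun x => (@?f x).1) => apply: (polytime_fst (f := f))
  | |- polytime_over _ (fun x => (@?f x).2) => apply: (polytime_snd (f := f))
  | |- polytime_over _ (fun x => @?f x :: @?g x) =>
      apply: (polytime_cons (f := f) (g := g))
  | |- polytime_over _ (fun x => @?f x ++ @?g x) =>
      apply: (polytime_cat (l := f) (r := g))
  | |- polytime_over _ (fun x => @?f x && @?g x) =>
      apply: (polytime_and (b := f) (c := g))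
  | |- polytime_over _ (fun x => @?f x || @?g x) =>
      apply: (polytime_or (b := f) (c := g))
  | |- polytime_over _ (fun x => @?f x ==> @?g x) =>
      apply: (polytime_imply (b := f) (c := g))
  | |- polytime_over _ (fun x => ~~ @?f x) => apply: (polytime_not (b := f))
  | |- polytime_over _ (fun x => @?f x == @?g x) =>
      apply: (polytime_eqop (f := f) (g := g))
  | |- polytime_over _ (fun x => in_mem (@?f x) (mem (@?l x))) =>
      apply: (polytime_mem (f := f) (l := l))
  | |- polytime_over _ (fun x => filter (@?P x) (@?l x)) =>
      apply: (polytime_filter (P := P) (l := l))
  | |- polytime_over _ (fun x => has (@?P x) (@?l x)) =>
      apply: (polytime_has (P := P) (l := l))
  | |- polytime_over _ (fun x => all (@?P x) (@?l x)) =>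
      apply: (polytime_all (P := P) (l := l))
  | |- polytime_over _ (fun x => map (@?f x) (@?l x)) =>
      apply: (polytime_map (f := f) (l := l))
  | |- polytime_over _ (fun x => flatten (@?l x)) =>
      apply: (polytime_flatten (l := l))
  | |- polytime_over _ (fun x => undup (@?l x)) =>
      apply: (polytime_undup (l := l))
  | |- polytime_over _ (fun x => seq_of_opt (@?f x)) =>
      apply: (polytime_seq_of_opt (f := f))
  | |- polytime_over _ (fun x => drop ?n (@?l x)) =>
      apply: (polytime_drop n (l := l))
  | |- polytime_over _ (fun x => behead (@?l x)) =>
      apply: (polytime_behead (l := l))
  | |- polytime_over _ (fun x => nilp (@?l x)) =>
      apply: (polytime_nilp (l := l))
  | |- polytime_over _ (fun x => head ?z (@?l x)) =>
      apply: (polytime_head z (l := l))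
  | _ => polytime_call
  end.

Ltac polytime_tac := repeat polytime_step.

Local Notation code := (code_over (symbol : finType)).
Local Notation polytime := (polytime_over (symbol : finType)).

Lemma polytime_Some X T `{encodable symbol X} `{encodable symbol T}
    (f : X -> T) : polytime f -> polytime (fun x => Some (f x)).
Proof. by move=> hf; apply: polytime_of_seq; rewrite /=; polytime_tac. Qed.

Lemma polytime_shrink X `{encodable symbol X}
    (Q : X -> seq letter -> letter -> bool) (V : X -> seq letter) :
  polytime (fun p : X * (seq letter * letter) => Q p.1 p.2.1 p.2.2) ->
  polytime V -> polytime (fun x => shrink (Q x) (V x)).
Proof.
move=> hQ hV; have [B pB hB] := polytime_size hV.
have filter_le (P : pred letter) (s : seq letter) :
    size (code (filter P s)) <= size (code s).
  elim: s => //= a s IH.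
  by case: (P a); rewrite !code_cons /= !size_cat; lia.
refine (polytime_iter (g := fun x R => filter (Q x R) R) _ hV hV pB _).
  apply: (polytime_filter (P := fun (p : X * seq letter) a => Q p.1 p.2 a)).
    apply: (polytime_comp (f := fun p : (X * seq letter) * letter =>
      (p.1.1, (p.1.2, p.2))) hQ).
    by polytime_tac.
  by polytime_tac.
move=> x i; apply: leq_trans (hB x).
by elim: i => //= i; apply: leq_trans; apply: filter_le.
Qed.

Lemma polytime_negatableb X `{encodable symbol X} (D : X -> seq default)
    (W : X -> seq literal) T y :
  polytime D -> polytime W -> polytime T -> polytime y ->
  polytime (fun x => negatableb (D x) (W x) (T x) (y x)).
Proof.
by move=> hD hW hT hy; rewrite /negatableb; polytime_tac.
Qed.

Lemma polytime_theory_letters X `{encodable symbol X} (D : X -> seq default)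
    (W : X -> seq literal) :
  polytime D -> polytime W -> polytime (fun x => theory_letters (D x) (W x)).
Proof.
move=> hD hW.
have : polytime (fun x =>
    flatten (map (fun d => seq_of_opt d.1 ++ [:: d.2.2]) (D x)) ++
    map snd (W x)) by polytime_tac.
apply: polytime_ext => x; congr (flatten _ ++ _).
by apply: eq_map => d; rewrite cats1.
Qed.

Lemma polytime_underivable X `{encodable symbol X} (D : X -> seq default)
    (W : X -> seq literal) T :
  polytime D -> polytime W -> polytime T ->
  polytime (fun x => underivable (D x) (W x) (T x)).
Proof.
move=> hD hW hT; rewrite /underivable; apply: polytime_shrink => //.
by polytime_tac.
Qed.

Ltac polytime_call ::= first
  [ apply: polytime_Some | apply: polytime_negatableb
  | apply: polytime_underivable | apply: polytime_theory_letters ].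

Lemma polytime_greatest X `{encodable symbol X} (D : X -> seq default)
    (W : X -> seq literal) F :
  polytime D -> polytime W -> polytime F ->
  polytime (fun x => greatest (D x) (W x) (F x)).
Proof.
by move=> hD hW hF; rewrite /greatest; apply: polytime_shrink; polytime_tac.
Qed.

Lemma polytime_closed_at_root X `{encodable symbol X} (D : X -> seq default)
    (W : X -> seq literal) T :
  polytime D -> polytime W -> polytime T ->
  polytime (fun x => closed_at_root (D x) (W x) (T x)).
Proof. by move=> hD hW hT; rewrite /closed_at_root; polytime_tac. Qed.

Ltac polytime_call ::= first
  [ apply: polytime_Some | apply: polytime_theory_letters
  | apply: polytime_greatest | apply: polytime_closed_at_root ].

Lemma polytime_avoidable X `{encodable symbol X} (D : X -> seq default)
    (W : X -> seq literal) l :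
  polytime D -> polytime W -> polytime l ->
  polytime (fun x => avoidable (D x) (W x) (l x)).
Proof.
move=> hD hW hl; rewrite /avoidable.
by apply: polytime_if; polytime_tac.
Qed.

Lemma polytime_unreachable X `{encodable symbol X} (D : X -> seq default)
    (W : X -> seq literal) a :
  polytime D -> polytime W -> polytime a ->
  polytime (fun x => unreachable (D x) (W x) (a x)).
Proof.
by move=> hD hW ha; rewrite /unreachable; apply: polytime_shrink; polytime_tac.
Qed.

Lemma polytime_lits_minus X `{encodable symbol X} (W V : X -> seq literal) :
  polytime W -> polytime V -> polytime (fun x => lits_minus (W x) (V x)).
Proof. by move=> hW hV; rewrite /lits_minus; polytime_tac. Qed.

Lemma polytime_consistentb X `{encodable symbol X} (W : X -> seq literal) :
  polytime W -> polytime (fun x => consistentb (W x)).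
Proof. by move=> hW; rewrite /consistentb; polytime_tac. Qed.

Ltac polytime_call ::= first
  [ apply: polytime_theory_letters | apply: polytime_lits_minus
  | apply: polytime_avoidable | apply: polytime_unreachable ].

Lemma polytime_tight c X `{encodable symbol X} (D : X -> seq default)
    (W : X -> seq literal) :
  polytime D -> polytime W -> polytime (fun x => tight c (D x) (W x)).
Proof. by move=> hD hW; rewrite /tight; polytime_tac. Qed.

Lemma polytime_witnessb X `{encodable symbol X} (D : X -> seq default)
    (W L S : X -> seq literal) :
  polytime D -> polytime W -> polytime L -> polytime S ->
  polytime (fun x => witnessb (D x) (W x) (L x) (S x)).
Proof. by move=> hD hW hL hS; rewrite /witnessb; polytime_tac. Qed.

(** Induction on k with X generalized: the literal chosen by the outer loop joins the argument of
    the inner search. *)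
Lemma polytime_search k X `{encodable symbol X}
    (P : X -> seq literal -> bool) (V acc : X -> seq literal) :
  polytime (fun p : X * seq literal => P p.1 p.2) ->
  polytime V -> polytime acc ->
  polytime (fun x => search k (P x) (V x) (acc x)).
Proof.
elim: k X H P V acc => [|k IH] X H P V acc hP hV hacc /=.
  apply: (polytime_comp (f := fun x => (x, acc x)) hP); polytime_tac.
apply: (polytime_has (P := fun x l => search k (P x) (V x) (l :: acc x))) => //.
apply: (IH _ _ (fun p => P p.1) (fun p => V p.1) (fun p => p.2 :: acc p.1)).
- apply: (polytime_comp (f := fun p : (X * literal) * seq literal =>
    (p.1.1, p.2)) hP); polytime_tac.
- polytime_tac.
- polytime_tac.
Qed.

Lemma polytime_outlierb c X `{encodable symbol X} (D : X -> seq default)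
    (W L : X -> seq literal) :
  polytime D -> polytime W -> polytime L ->
  polytime (fun x => outlierb c (D x) (W x) (L x)).
Proof.
move=> hD hW hL; rewrite /outlierb; apply: polytime_and; first by polytime_tac.
apply: (@polytime_search c X _ (fun x => witnessb (D x) (W x) (L x))).
- by apply: polytime_witnessb; polytime_tac.
- by apply: polytime_lits_minus.
- by polytime_tac.
Qed.

(** * Reading an instance *)

Arguments encode_literal : simpl never.

Definition split_step (sep a : symbol) (st : seq (seq symbol)) :
  seq (seq symbol) :=
  if a == sep then [::] :: st
  else if st is s :: r then (a :: s) :: r else [::].

(* With [init = [:: [::]]] the separators stand between the parts, and with
   [init = [::]] they end them. *)
Definition split (sep : symbol) (init : seq (seq symbol)) (w : seq symbol) :
  seq (seq symbol) := foldr (split_step sep) init w.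

Definition symbol_bool (a : symbol) : bool :=
  match a with Bit b | Sign b => b | _ => false end.

(** The word is read from the right, so the bits of a letter are collected before the sign that
    opens its literal. *)
Definition literal_step (a : symbol) (p : seq bool * seq literal) :
  seq bool * seq literal :=
  if is_bit a then (symbol_bool a :: p.1, p.2)
  else if is_sign a then ([::], (symbol_bool a, p.1) :: p.2) else p.

Definition parse_literals (w : seq symbol) : seq literal :=
  (foldr literal_step ([::], [::]) w).2.

Definition parse_default (w : seq symbol) : default :=
  let q := split Colon [:: [::]] w in
  (ohead (map snd (parse_literals (head [::] q))),
   head (false, [::]) (parse_literals (head [::] (behead q)))).

Definition parse (w : seq symbol) : seq default * (seq literal * seq literal) :=
  let q := split Bar [:: [::]] w in
  (map parse_default (split Semicolon [::] (head [::] q)),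
   (parse_literals (head [::] (behead q)),
    parse_literals (head [::] (behead (behead q))))).

Lemma split_cat sep init s w : sep \notin s ->
  split sep init (s ++ sep :: w) = s :: split sep init w.
Proof.
rewrite /split foldr_cat /= {2}/split_step eqxx.
elim: s => //= a s IH; rewrite inE negb_or => /andP[na /IH ->].
by rewrite /split_step eq_sym (negbTE na).
Qed.

Lemma split_last sep s : sep \notin s -> split sep [:: [::]] s = [:: s].
Proof.
rewrite /split; elim: s => //= a s IH; rewrite inE negb_or => /andP[na /IH ->].
by rewrite /split_step eq_sym (negbTE na).
Qed.

Lemma parse_literalsK W : parse_literals (flatten (map encode_literal W)) = W.
Proof.
rewrite /parse_literals; suff -> : foldr literal_step ([::], [::])
  (flatten (map encode_literal W)) = ([::], W) by [].
elim: W => //= -[b x] W IH; rewrite /encode_literal /= foldr_cat IH.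
have -> : foldr literal_step ([::], W) (map Bit x) = (x, W).
  by elim: x => //= c x ->.
by [].
Qed.

Lemma parse_literalK l : parse_literals (encode_literal l) = [:: l].
Proof. by have := parse_literalsK [:: l]; rewrite /= cats0. Qed.

Lemma encode_literal_notin (a : symbol) l :
  ~~ is_bit a -> ~~ is_sign a -> a \notin encode_literal l.
Proof.
move=> nb ns; rewrite inE negb_or; apply/andP; split.
  by apply: contraNneq ns => ->.
by apply/mapP => -[b _ e]; rewrite e in nb.
Qed.

Lemma encode_literals_notin (a : symbol) W :
  ~~ is_bit a -> ~~ is_sign a -> a \notin flatten (map encode_literal W).
Proof.
move=> nb ns; apply/flattenP => -[s /mapP[l _ ->]].
by apply/negP; apply: encode_literal_notin.
Qed.

(** The optional prerequisite is written as a flattened sequence, a form that suits both parsing and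
    the time bound of the encoder. *)
Definition default_body (d : default) : seq symbol :=
  flatten (map (fun a => encode_literal (true, a)) (seq_of_opt d.1)) ++
  Colon :: encode_literal d.2.

Lemma encode_defaultE d : encode_default d = default_body d ++ [:: Semicolon].
Proof.
case: d => [[a|] l]; rewrite /encode_default /default_body /=.
  by rewrite cats0 -catA.
by [].
Qed.

Lemma default_body_notin (a : symbol) d :
  ~~ is_bit a -> ~~ is_sign a -> a != Colon -> a \notin default_body d.
Proof.
move=> nb ns nc; rewrite mem_cat in_cons.
apply/negP => /orP[|/predU1P[e|]]; last exact/negP/encode_literal_notin.
  by rewrite map_comp; apply/negP/encode_literals_notin.
by rewrite e eqxx in nc.
Qed.

Lemma parse_defaultK d : parse_default (default_body d) = d.
Proof.
have nC l : Colon \notin encode_literal l by apply: encode_literal_notin.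
rewrite /parse_default /default_body split_cat; last first.
  by rewrite map_comp encode_literals_notin.
rewrite split_last ?nC // /head /behead parse_literalK map_comp parse_literalsK.
by case: d => [[a|] l].
Qed.

Lemma parseK D W L : parse (encode_instance D W L) = (D, (W, L)).
Proof.
rewrite /parse /encode_instance.
have nD : Bar \notin flatten (map encode_default D).
  apply/flattenP => -[s /mapP[d _ ->]]; apply/negP; rewrite encode_defaultE.
  by rewrite mem_cat inE orbF; apply: default_body_notin.
rewrite !split_cat ?split_last //; try exact: encode_literals_notin.
rewrite /head /behead !parse_literalsK; congr (_, _).
elim: D {nD} => //= d D IH; rewrite encode_defaultE -catA /=.
by rewrite split_cat ?default_body_notin //= parse_defaultK IH.
Qed.

(** [parse] returns an instance for every word; comparing its encoding with w rejects the words that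
    encode nothing, so [parse] has to be right only on encodings. *)
Definition decide (c : nat) (w : seq symbol) : bool :=
  let q := parse w in
  [&& encode_instance q.1 q.2.1 q.2.2 == w, consistentb q.2.1,
      tight c q.1 q.2.1 & outlierb c q.1 q.2.1 q.2.2].

Lemma decideP c : 0 < c ->
  strong_outlier_recognition c = [set w | decide c w]%classic.
Proof.
move=> c0; apply/seteqP; split=> w /=.
  case=> [D [W [L [-> /consistentP cW tc out]]]]; rewrite /decide parseK.
  apply/and4P; split; [exact/eqP|exact/consistentbP|by rewrite tightP|].
  exact/outlierP.
case/and4P=> /eqP e /consistentbP cW; rewrite tightP => tc out.
exists (parse w).1, (parse w).2.1, (parse w).2.2; split=> //.
  exact/consistentP.
by apply/(outlierP _ cW c0 tc).
Qed.

Lemma polytime_symbol X `{encodable symbol X} (P : symbol -> bool)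
    (f : X -> symbol) :
  polytime f -> polytime (fun x => P (f x)).
Proof. exact: (polytime_comp (polytime_base_pred P)). Qed.

Lemma size_code_split sep init (r : seq symbol) :
  size (code (foldr (split_step sep) init r)) <= 2 * size r + size (code init).
Proof.
elim: r => [|a r] //=; rewrite /split_step; case: eqP => _.
  by rewrite code_cons code_nil /=; lia.
case: (foldr _ _ _) => [|s st]; first by rewrite code_nil /=; lia.
by rewrite !code_cons code_base /= !size_cat /=; lia.
Qed.

(** The costliest symbol is a sign: it adds a cons node, a pair node, a fresh empty letter and a
    boolean of size at most 3. *)
Lemma size_code_literals (r : seq symbol) :
  size (code (foldr literal_step ([::], [::]) r)) <= 6 * size r + 3.
Proof.
elim: r => [|a r] /=; first by rewrite code_pair !code_nil.
case: (foldr _ _ _) => u v.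
rewrite /literal_step; case: (is_bit a).
  rewrite !code_pair code_cons /= !size_cat.
  set b := size (code_over _ (symbol_bool a)).
  have : b <= 3 by apply: size_code_bool.
  lia.
case: (is_sign a); rewrite !code_pair ?code_cons ?code_nil /= !size_cat;
  last lia.
rewrite code_pair /= size_cat; set b := size (code_over _ (symbol_bool a)).
have : b <= 3 by apply: size_code_bool.
rewrite /letter; lia.
Qed.

Lemma polytime_split X `{encodable symbol X} sep init (w : X -> seq symbol) :
  polytime w -> polytime (fun x => split sep init (w x)).
Proof.
move=> hw; have [B pB hB] := polytime_size hw.
refine (polytime_foldr (g := fun _ => split_step sep) (s0 := fun=> init)
  (B := fun n => 2 * B n + size (code init)) _ hw _ _ _).
- apply: polytime_if.
  + by apply: (polytime_symbol (fun a => a == sep)); polytime_tac.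
  + by polytime_tac.
  + apply: (polytime_seq_case (l := fun p : _ * (_ * _) => p.2.2)
      (f := fun p s r => (p.2.1 :: s) :: r) (g := fun=> [::])); polytime_tac.
- by polytime_tac.
- by auto with polybound.
- move=> x i; have := leq_trans (size_code_drop i (w x)) (hB x).
  have : size (drop i (w x)) < size (code (drop i (w x))).
    exact: leq_size_code.
  have : size (code (foldr (split_step sep) init (drop i (w x)))) <=
    2 * size (drop i (w x)) + size (code init) by apply: size_code_split.
  lia.
Qed.

Lemma polytime_parse_literals X `{encodable symbol X}
    (w : X -> seq symbol) :
  polytime w -> polytime (fun x => parse_literals (w x)).
Proof.
move=> hw; have [B pB hB] := polytime_size hw; apply: polytime_snd.
refine (polytime_foldr (g := fun _ => literal_step) (s0 := fun=> ([::], [::]))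
  (B := fun n => 6 * B n + 3) _ hw _ _ _).
- have hb : polytime (fun p : X * (symbol * (seq bool * seq literal)) =>
    symbol_bool p.2.1) by apply: polytime_symbol; polytime_tac.
  apply: polytime_if; first by apply: polytime_symbol; polytime_tac.
    by polytime_tac.
  apply: polytime_if; first by apply: polytime_symbol; polytime_tac.
    by polytime_tac.
  by polytime_tac.
- by polytime_tac.
- by auto with polybound.
- move=> x i; have := leq_trans (size_code_drop i (w x)) (hB x).
  have : size (drop i (w x)) < size (code (drop i (w x))).
    exact: leq_size_code.
  have : size (code (foldr literal_step ([::], [::]) (drop i (w x)))) <=
    6 * size (drop i (w x)) + 3 by apply: size_code_literals.
  lia.
Qed.

Ltac polytime_call ::= first
  [ apply: polytime_split | apply: polytime_parse_literals ].

Lemma polytime_parse_default X `{encodable symbol X}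
    (w : X -> seq symbol) :
  polytime w -> polytime (fun x => parse_default (w x)).
Proof.
move=> hw; rewrite /parse_default; apply: polytime_pair; last by polytime_tac.
apply: polytime_of_seq.
pose l x := map snd (parse_literals (head [::] (split Colon [:: [::]] (w x)))).
have hl : polytime l by rewrite /l; polytime_tac.
have : polytime (fun x => if l x is a :: _ then [:: a] else [::]).
  apply: (polytime_seq_case (f := fun _ a _ => [:: a]) (g := fun=> [::]) hl).
    by polytime_tac.
  by polytime_tac.
by apply: polytime_ext => x; rewrite /l; case: (map _ _).
Qed.

Lemma polytime_encode_literal X `{encodable symbol X} (l : X -> literal) :
  polytime l -> polytime (fun x => encode_literal (l x)).
Proof.
move=> hl.
have : polytime (fun x => (if (l x).1 then Sign true else Sign false) ::
    map (fun b => if b then Bit true else Bit false) (l x).2).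
  apply: polytime_cons; first by apply: polytime_if; polytime_tac.
  apply: (polytime_map
    (f := fun _ (b : bool) => if b then Bit true else Bit false)).
    by apply: polytime_if; polytime_tac.
  by polytime_tac.
apply: polytime_ext => x; rewrite /encode_literal; congr (_ :: _).
  by case: (l x).1.
by apply: eq_map => -[].
Qed.

Ltac polytime_call ::= first
  [ apply: polytime_split | apply: polytime_parse_literals
  | apply: polytime_parse_default | apply: polytime_encode_literal ].

Lemma polytime_parse : polytime parse.
Proof.
have : polytime (fun w : seq symbol => parse w).
  by rewrite /parse; polytime_tac.
by apply: polytime_ext.
Qed.

Lemma polytime_encode_instance X `{encodable symbol X} D W L :
  polytime (D : X -> _) -> polytime W -> polytime L ->
  polytime (fun x => encode_instance (D x) (W x) (L x)).
Proof.
move=> hD hW hL.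
have : polytime (fun x =>
    flatten (map (fun d => default_body d ++ [:: Semicolon]) (D x)) ++
    Bar :: flatten (map encode_literal (W x)) ++
    Bar :: flatten (map encode_literal (L x))).
  by rewrite /default_body; polytime_tac.
apply: polytime_ext => x; congr (flatten _ ++ _).
by apply: eq_map => d; rewrite encode_defaultE.
Qed.

Lemma polytime_decide c : polytime (decide c).
Proof.
have hp := polytime_parse.
have h1 : polytime (fun w => (parse w).1) by polytime_tac.
have h2 : polytime (fun w => (parse w).2.1) by polytime_tac.
have h3 : polytime (fun w => (parse w).2.2) by polytime_tac.
apply: polytime_and.
  apply: polytime_eqop; [by polytime_tac| |by polytime_tac].
  exact: polytime_encode_instance.
apply: polytime_and; first exact: polytime_consistentb.
apply: polytime_and; first exact: polytime_tight.
exact: polytime_outlierb.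
Qed.

Theorem theorem5p8 (c : nat) (c_gt0 : 0 < c) :
  in_P (strong_outlier_recognition c).
Proof.
rewrite decideP //; apply: in_P_polytime; exact: polytime_decide.
Qed.
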